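(* Let $X, Y$ be compact Hausdorff spaces, let $E, F$ be unital commutative semisimple Banach algebras which are Ditkin algebras, and let $T:C(X,E)\to C(Y,F)$ be a separating linear bijection. Then (i) $T$ is continuous; (ii) $T^{-1}$ is separating; and (iii) $X\times M(E)$ and $Y\times M(F)$ are homeomorphic.
   Context: Banach algebras are over $\mathbb{C}$. $C(X,E)$ is the algebra of all continuous maps $X\to E$ with pointwise operations and the norm $\|f\|_X=\sup_{x\in X}\|f(x)\|$; it is a commutative Banach algebra with unit, and it is semisimple when $E$ is semisimple. Let $A$ be a commutative Banach algebra with unit. $M(A)$ is the set of nonzero multiplicative linear functionals $A\to\mathbb{C}$ with the relative weak-star topology from $A^*$, and $\hat a(\phi)=\phi(a)$. $A$ is semisimple if $a\mapsto\hat a$ is injective. Put $\mathrm{coz}(a)=\{\phi\in M(A):\hat a(\phi)\neq0\}$ and let $\mathrm{supp}(a)$ be its closure in $M(A)$. For $\phi\in M(A)$ put $I_\phi=\{a\in A:\hat a(\phi)=0\}$ and $J_\phi=\{a\in A:\phi\notin\mathrm{supp}(a)\}$. $A$ is a Ditkin algebra if for every $\phi\in M(A)$ and every $a\in I_\phi$, $a$ belongs to the norm closure of $aJ_\phi=\{ab:b\in J_\phi\}$. A linear map $T:A_1\to A_2$ between semisimple commutative Banach algebras with identity is separating if $\mathrm{coz}(Tf)\cap\mathrm{coz}(Tg)=\emptyset$ whenever $f,g\in A_1$ satisfy $\mathrm{coz}(f)\cap\mathrm{coz}(g)=\emptyset$ (equivalently, $Tf\cdot Tg=0$ whenever $f\cdot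 g=0$). *)

(* Defs.v *)
From HB Require Import structures.
From mathcomp Require Import all_boot all_order all_algebra.
From mathcomp Require Import complex.
From mathcomp Require Import all_classical all_reals all_analysis.
From mathcomp Require Import ring.

Set Implicit Arguments.
Unset Strict Implicit.
Unset Printing Implicit Defensive.

Import Order.TTheory GRing.Theory Num.Theory.
Import numFieldNormedType.Exports.

Local Open Scope classical_set_scope.
Local Open Scope ring_scope.
Local Open Scope complex_scope.

HB.mixin Record isCompactHausdorff T & Topological T := {
  compact_setT : compact [set: T];
  hausdorff_setT : hausdorff_space T
}.

#[short(type="compactHausdorffType")]
HB.structure Definition CompactHausdorff :=
  {T of Topological T & isCompactHausdorff T}.

(* HB has no join of the ring structures with the normed-module ones, so the
   multiplication is part of this mixin and the [comPzRingType] structure is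
   derived below.  The axiom 1 != 0 is not imposed: C(X, E) is the zero algebra
   when X is empty. *)
HB.mixin Record isComBanachAlgebra (K : numFieldType) A
    & CompleteNormedModule K A := {
  banach_one : A;
  banach_mul : A -> A -> A;
  banach_mulA : associative banach_mul;
  banach_mulC : commutative banach_mul;
  banach_mul1r : left_id banach_one banach_mul;
  banach_mulDl : left_distributive banach_mul +%R;
  banach_scalerAl : forall (k : K) (a b : A),
    k *: banach_mul a b = banach_mul (k *: a) b;
  banach_normrM : forall a b : A, `|banach_mul a b| <= `|a| * `|b|
}.

#[short(type="comBanachAlgType")]
HB.structure Definition ComBanachAlgebra (K : numFieldType) :=
  {A of CompleteNormedModule K A & isComBanachAlgebra K A}.

HB.instance Definition _ (K : numFieldType) (A : comBanachAlgType K) :=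
  GRing.Zmodule_isComPzRing.Build (ComBanachAlgebra.sort A)
    banach_mulA banach_mulC banach_mul1r banach_mulDl.

Section banach_theory.
Variables (K : numFieldType) (A : comBanachAlgType K).
Implicit Types a b : A.

Lemma banachZAl (k : K) a b : k *: (a * b) = (k *: a) * b.
Proof. exact: banach_scalerAl. Qed.

Lemma banach_ler_normM a b : `|a * b| <= `|a| * `|b|.
Proof. exact: banach_normrM. Qed.

Lemma banach_mul_continuous : continuous (fun z : A * A => z.1 * z.2).
Proof.
move=> [/= k x]; apply/cvgrPdist_lt => _/posnumP[e]; near +oo_K => M.
near=> l z => /=; have M0 : 0 < M by [].
rewrite (@distm_lt_split _ _ (k * z)) // -?(mulrBr, mulrBl).
  rewrite (le_lt_trans (banach_ler_normM _ _))//.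
  rewrite (@le_lt_trans _ _ (M * `|x - z|)) ?ler_wpM2r -?ltr_pdivlMl//.
  by near: z; apply: cvgr_dist_lt; rewrite // mulr_gt0 ?invr_gt0.
rewrite (le_lt_trans (banach_ler_normM _ _))//.
rewrite (@le_lt_trans _ _ (`|k - l| * M)) ?ler_wpM2l -?ltr_pdivlMr//.
  by near: z; near: M; apply: cvg_bounded (@cvg_refl _ _).
by near: l; apply: cvgr_dist_lt; rewrite // divr_gt0.
Unshelve. all: by end_near. Qed.

End banach_theory.

Section contfun_def.
Variables (R : realType) (X : compactHausdorffType) (E : comBanachAlgType R[i]).

Definition contfun : Type := continuousType X E.

Definition contfun_apply (f : contfun) : X -> E := f.
Coercion contfun_apply : contfun >-> Funclass.

HB.instance Definition _ := Choice.copy contfun (continuousType X E).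

Implicit Types f g h : contfun.

Definition mkcontfun (f : X -> E) (fc : continuous f) : contfun :=
  (mkcts fc : continuousType X E).

Lemma contfun_continuous f : continuous (f : X -> E).
Proof. exact: (@cts_fun _ _ f). Qed.

Lemma contfunP f g : (forall x, f x = g x) -> f = g.
Proof. by move=> fg; apply/continuousEP => x; exact: fg. Qed.

Let zero_continuous : continuous (fun _ : X => 0 : E).
Proof. by move=> x; exact: cvg_cst. Qed.

Let one_continuous : continuous (fun _ : X => 1 : E).
Proof. by move=> x; exact: cvg_cst. Qed.

Let add_continuous f g : continuous (fun x => f x + g x).
Proof.
by move=> x; exact: cvgD (@contfun_continuous f x) (@contfun_continuous g x).
Qed.

Let opp_continuous f : continuous (fun x => - f x).
Proof. by move=> x; exact: cvgN (@contfun_continuous f x). Qed.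

Let scale_continuous (k : R[i]) f : continuous (fun x => k *: f x).
Proof. by move=> x; exact: cvgZl_tmp (@contfun_continuous f x). Qed.

Let mul_continuous f g : continuous (fun x => f x * g x).
Proof.
move=> x; apply: (@cvg_comp _ _ _ (fun x => (f x, g x)) (fun z => z.1 * z.2)).
  exact: cvg_pair (@contfun_continuous f x) (@contfun_continuous g x).
exact: (@banach_mul_continuous _ E (f x, g x)).
Qed.

Definition contfun_zero := mkcontfun zero_continuous.
Definition contfun_one := mkcontfun one_continuous.
Definition contfun_add f g := mkcontfun (@add_continuous f g).
Definition contfun_opp f := mkcontfun (@opp_continuous f).
Definition contfun_scale k f := mkcontfun (@scale_continuous k f).
Definition contfun_mul f g := mkcontfun (@mul_continuous f g).

Let addA : associative contfun_add.
Proof. by move=> f g h; apply: contfunP => x; exact: addrA. Qed.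
Let addC : commutative contfun_add.
Proof. by move=> f g; apply: contfunP => x; exact: addrC. Qed.
Let add0 : left_id contfun_zero contfun_add.
Proof. by move=> f; apply: contfunP => x; exact: add0r. Qed.
Let addN : left_inverse contfun_zero contfun_opp contfun_add.
Proof. by move=> f; apply: contfunP => x; exact: addNr. Qed.

HB.instance Definition _ := GRing.isZmodule.Build contfun addA addC add0 addN.

Let scaleA a b f :
  contfun_scale a (contfun_scale b f) = contfun_scale (a * b) f.
Proof. by apply: contfunP => x; exact: scalerA. Qed.
Let scale1 : left_id 1 contfun_scale.
Proof. by move=> f; apply: contfunP => x; exact: scale1r. Qed.
Let scaleDr : right_distributive contfun_scale +%R.
Proof. by move=> a f g; apply: contfunP => x; exact: scalerDr. Qed.
Let scaleDl f : {morph contfun_scale^~ f : a b / a + b}.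
Proof. by move=> a b; apply: contfunP => x; exact: scalerDl. Qed.

HB.instance Definition _ := GRing.Zmodule_isLmodule.Build R[i] contfun
  scaleA scale1 scaleDr scaleDl.


(* The norm of a normed module over R[i] takes its values in R[i]; the supremum
   is taken in R.  By convention sup set0 = 0, for X empty. *)
Definition contfun_norm f : R := sup (range (fun x => complex.Re `|f x|)).

Let normE (v : E) : `|v| = (complex.Re `|v|)%:C.
Proof. by rewrite RRe_real// normr_real. Qed.

Let Re_norm_continuous f : continuous (fun x => complex.Re `|f x| : R).
Proof.
move=> x; apply/cvgrPdist_lt => e e0.
have e0' : 0 < e%:C by rewrite ltcR.
have /cvgrPdist_lt/(_ _ e0') := @contfun_continuous f x.
apply: filterS => y fxy; rewrite -ltcR (le_lt_trans _ fxy)//.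
have := ler_dist_dist (f x) (f y).
by rewrite (normE (f x)) (normE (f y)) -rmorphB normc_def/= expr0n addr0
  sqrtr_sqr.
Qed.

Lemma contfun_norm_ub f x : `|f x| <= (contfun_norm f)%:C.
Proof.
rewrite normE lecR; apply: ub_le_sup; last by exists x.
have : compact (range (fun x => complex.Re `|f x| : R)).
  apply: continuous_compact; last exact: compact_setT.
  exact/continuous_subspaceT/Re_norm_continuous.
by case/(compact_has_sup _) => //; exists (complex.Re `|f x|), x.
Qed.

Lemma contfun_norm_le f (M : R) : 0 <= M -> (forall x, `|f x| <= M%:C) ->
  contfun_norm f <= M.
Proof.
move=> M0 fM; have [X0|/set0P] := eqVneq [set: X] set0.
  by rewrite /contfun_norm X0 image_set0 sup0.
move=> [x _]; apply: ge_sup; first by exists (complex.Re `|f x|), x.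
by move=> _ [y _ <-]; rewrite -lecR -normE.
Qed.

Lemma contfun_norm_ge0 f : 0 <= contfun_norm f.
Proof.
have [X0|/set0P[x _]] := eqVneq [set: X] set0.
  by rewrite /contfun_norm X0 image_set0 sup0.
by rewrite -lecR (le_trans _ (contfun_norm_ub f x)).
Qed.

Let normD f g :
  (contfun_norm (f + g))%:C <= (contfun_norm f)%:C + (contfun_norm g)%:C.
Proof.
rewrite -rmorphD lecR contfun_norm_le ?addr_ge0 ?contfun_norm_ge0// => x.
by rewrite (le_trans (ler_normD _ _))// rmorphD lerD// contfun_norm_ub.
Qed.

Let normZ_le (k : R[i]) f :
  (contfun_norm (k *: f))%:C <= `|k| * (contfun_norm f)%:C.
Proof.
rewrite -(RRe_real (normr_real k)) -rmorphM lecR contfun_norm_le//.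
  apply: mulr_ge0; last exact: contfun_norm_ge0.
  by rewrite -lecR RRe_real ?normr_real ?normr_ge0.
move=> x; rewrite rmorphM.
rewrite -[X in _ <= X * _]/((complex.Re `|k|)%:C) RRe_real ?normr_real//.
apply: (@le_trans _ _ (`|k| * `|f x|)); first by rewrite -normrZ.
by rewrite ler_wpM2l// contfun_norm_ub.
Qed.

Let normZ (k : R[i]) f :
  (contfun_norm (k *: f))%:C = `|k| * (contfun_norm f)%:C.
Proof.
apply/eqP; rewrite eq_le normZ_le/=; have [->|k0] := eqVneq k 0.
  by rewrite normr0 mul0r lecR contfun_norm_ge0.
rewrite -ler_pdivlMl ?normr_gt0// -normfV.
by rewrite -{1}(scalerK k0 f) normZ_le.
Qed.

Let norm0_eq0 f : (contfun_norm f)%:C = 0 -> f = 0.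
Proof.
move=> f0; apply: contfunP => x.
by apply/normr0_eq0/eqP; rewrite eq_le normr_ge0 andbT -f0 contfun_norm_ub.
Qed.

HB.instance Definition _ := Lmodule_isNormed.Build R[i] contfun
  normD normZ norm0_eq0.

Lemma contfun_normE f : `|f| = (contfun_norm f)%:C.
Proof. by []. Qed.

Let le_norm_apply f x : `|f x| <= `|f|.
Proof. exact: contfun_norm_ub. Qed.

Let le_dist_apply f g x : `|f x - g x| <= `|f - g|.
Proof. exact: (le_norm_apply (f - g)). Qed.

Let norm_le f (e : R[i]) : 0 <= e -> (forall x, `|f x| <= e) -> `|f| <= e.
Proof.
move=> e0 fe; have eE : e = (complex.Re e)%:C by rewrite RRe_real// ger0_real.
rewrite contfun_normE eE lecR contfun_norm_le -?lecR -?eE//.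
Qed.

Let complete (F : set_system contfun) : ProperFilter F -> cauchy F -> cvg F.
Proof.
move=> FF /cauchyP Fc.
have Fcx x : cvg ((fun f : contfun => f x) @ F).
  apply: cauchy_cvg; apply/cauchy_exP => e e0.
  have [f Ff] := Fc _ e0; exists (f x).
  change (F [set h : contfun | ball (f x) e (h x)]); apply: filterS Ff => h.
  rewrite -!ball_normE/=; apply: le_lt_trans; exact: le_dist_apply.
pose g x : E := lim ((fun f : contfun => f x) @ F).
have Fg e : 0 < e -> F [set f : contfun | forall x, `|g x - f x| <= e].
  move=> e0; have e30 : 0 < e / 3 by rewrite divr_gt0.
  have [h Fh] := Fc _ e30.
  have dist f x : ball h (e / 3) f -> `|h x - f x| <= e / 3.
    by rewrite -ball_normE/= => /ltW; apply: le_trans; exact: le_dist_apply.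
  have := Fh; apply: filterS => f hf x.
  have /cvgrPdist_le/(_ _ e30) gx := Fcx x.
  near F => k.
  have -> : e = e / 3 + (e / 3 + e / 3) by field.
  rewrite (le_trans (ler_distD (k x) _ _))// lerD//; first by near: k.
  rewrite (le_trans (ler_distD (h x) _ _))// lerD//; last exact: dist.
  by rewrite distrC; apply: dist; near: k; exact: Fh.
have gc : continuous g.
  move=> x; apply/cvgrPdist_le => e e0; have e30 : 0 < e / 3 by rewrite divr_gt0.
  near F => f.
  have gf y : `|g y - f y| <= e / 3 by move: y; near: f; exact: Fg.
  have /cvgrPdist_le/(_ _ e30) := @contfun_continuous f x.
  apply: filterS => y fxy.
  have -> : e = e / 3 + (e / 3 + e / 3) by field.
  rewrite (le_trans (ler_distD (f x) _ _))// lerD//.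
  by rewrite (le_trans (ler_distD (f y) _ _))// lerD// distrC.
apply/cvg_ex; exists (mkcontfun gc); apply/cvgrPdist_le => e e0.
apply: filterS (Fg _ e0) => f gf; apply: norm_le; first exact: ltW.
exact: gf.
Unshelve. all: by end_near. Qed.

HB.instance Definition _ := Uniform_isComplete.Build contfun complete.

Let mulA : associative contfun_mul.
Proof. by move=> f g h; apply: contfunP => x; exact: mulrA. Qed.
Let mulC : commutative contfun_mul.
Proof. by move=> f g; apply: contfunP => x; exact: mulrC. Qed.
Let mul1 : left_id contfun_one contfun_mul.
Proof. by move=> f; apply: contfunP => x; exact: mul1r. Qed.
Let mulDl : left_distributive contfun_mul +%R.
Proof. by move=> f g h; apply: contfunP => x; exact: mulrDl. Qed.
Let scaleAl (k : R[i]) f g : k *: contfun_mul f g = contfun_mul (k *: f) g.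
Proof. by apply: contfunP => x; exact: banachZAl. Qed.
Let normM f g : `|contfun_mul f g| <= `|f| * `|g|.
Proof.
apply: norm_le => [|x]; first by rewrite mulr_ge0.
by rewrite (le_trans (banach_ler_normM _ _))// ler_pM.
Qed.

HB.instance Definition _ := isComBanachAlgebra.Build R[i] contfun
  mulA mulC mul1 mulDl scaleAl normM.
HB.instance Definition _ := GRing.ComPzRing.copy contfun
  (ComBanachAlgebra.sort (contfun : comBanachAlgType R[i])).

End contfun_def.

Section gelfand.
Variables (R : realType) (A : comBanachAlgType R[i]).

Definition is_character (phi : A -> R[i]^o) : Prop :=
  [/\ linear phi, {morph phi : a b / a * b} & exists a, phi a != 0].

(* Multiplicative functionals are automatically continuous, and the weak-star
   topology is that of pointwise convergence on A; [set_type] carries the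
   subspace topology. *)
Definition maxspec : Type :=
  set_type [set phi : {ptws A -> R[i]^o} | is_character phi].

HB.instance Definition _ := Topological.on maxspec.

Definition gelfand (a : A) (phi : maxspec) : R[i] := set_val phi a.

Definition semisimple : Prop := injective gelfand.

Definition coz (a : A) : set maxspec := [set phi | gelfand a phi != 0].

Definition supp (a : A) : set maxspec := closure (coz a).

Definition ideal_I (phi : maxspec) : set A := [set a | gelfand a phi = 0].

Definition ideal_J (phi : maxspec) : set A := [set a | ~ supp a phi].

Definition ditkin : Prop := forall (phi : maxspec) (a : A), ideal_I phi a ->
  closure [set a * b | b in ideal_J phi] a.

End gelfand.

Definition separating (R : realType) (A1 A2 : comBanachAlgType R[i])
    (T : A1 -> A2) : Prop :=
  forall f g : A1, coz f `&` coz g = set0 -> coz (T f) `&` coz (T g) = set0.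

Definition homeomorphic (U V : topologicalType) : Prop :=
  exists (f : U -> V) (g : V -> U),
    [/\ cancel f g, cancel g f, continuous f & continuous g].

(* Main.v *)
(* The algebra C(X, E) acts as an algebra of functions on K = X * M(E), and
   C(Y, F) on L = Y * M(F).  As F has a unit and T is onto, each y in L has a
   support point h y in K: every neighbourhood of h y carries some f with
   T f (y) <> 0.  Since T is separating, T f (y) = 0 as soon as f vanishes near
   h y; hence h is continuous, and onto because T is injective.  Ditkin's
   condition turns this into T f (y) = T 1 (y) * f (h y) at the points y where
   f |-> T f (y) is bounded; a gliding hump shows that the other points lie above
   a finite subset of K, and bijectivity of T that there are none.  The formula
   yields (ii) and the injectivity of h, hence (iii), and the closed graph theorem
   yields (i).  That proper ideals of E lie in kernels of characters is the
   Gelfand-Mazur theorem, obtained without complex integration by averaging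
   resolvents over roots of unity. *)

Require Import Defs.
From HB Require Import structures.
From mathcomp Require Import all_boot all_order all_algebra.
From mathcomp Require Import cyclic separable cyclotomic complex.
From mathcomp Require Import all_classical all_reals all_analysis.
From mathcomp Require Import ring lra.

Set Implicit Arguments.
Unset Strict Implicit.
Unset Printing Implicit Defensive.

Import Order.TTheory GRing.Theory Num.Theory.
Import numFieldNormedType.Exports.

Local Open Scope classical_set_scope.
Local Open Scope ring_scope.

(** * Real-valued norms and completeness *)

(** Continuity of T is a conclusion, so at first no functional f |-> T f (y) is known to be bounded.
    Ditkin's condition only makes an element vanishing at [h y] a limit of elements vanishing near
    [h y], and such a limit says nothing about T f (y) without a bound. Even when all these
    functionals are bounded, uniformly in y, the norm of T f is not yet controlled, because in a
    semisimple algebra the Gelfand transform need not control the norm; this is why a closed graph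
    argument remains at the end. Ideals do the localising work: one that lies in no kernel of an
    evaluation contains 1, which yields both the support points and the elements equal to 1 near a
    point. In the Gelfand-Mazur part, a resolvent defined on the whole plane forces t^n a^n to tend
    to 0 modulo the ideal for every t, as for spectral radius 0, and an element invertible modulo a
    proper ideal cannot behave so. *)

Section real_norm.
Local Open Scope complex_scope.
Variable R : realType.

(* The norm of a normed module over R[i] is R[i]-valued; this is the
   corresponding element of R. *)
Definition rnorm (V : normedZmodType R[i]) (v : V) : R := complex.Re `|v|.

Lemma rnormE (V : normedZmodType R[i]) (v : V) : `|v| = (rnorm v)%:C.
Proof. by rewrite /rnorm RRe_real// normr_real. Qed.

Section zmodule.
Variable V : normedZmodType R[i].
Implicit Types u v w : V.

Lemma rnorm_ge0 v : 0 <= rnorm v.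
Proof. by rewrite -lecR -rnormE normr_ge0. Qed.

Lemma rnorm0 : rnorm (0 : V) = 0.
Proof. by rewrite /rnorm normr0. Qed.

Lemma rnorm_eq0 v : rnorm v = 0 -> v = 0.
Proof. by move=> v0; apply: normr0_eq0; rewrite rnormE v0. Qed.

Lemma rnormN v : rnorm (- v) = rnorm v.
Proof. by rewrite /rnorm normrN. Qed.

Lemma rdistC u v : rnorm (u - v) = rnorm (v - u).
Proof. by rewrite /rnorm distrC. Qed.

Lemma ler_rnormD u v : rnorm (u + v) <= rnorm u + rnorm v.
Proof. by rewrite -lecR rmorphD/= -!rnormE ler_normD. Qed.

Lemma ler_rnormB u v : rnorm (u - v) <= rnorm u + rnorm v.
Proof. by rewrite -[rnorm v]rnormN ler_rnormD. Qed.

Lemma ler_rdistD w u v : rnorm (u - v) <= rnorm (u - w) + rnorm (w - v).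
Proof. by rewrite -{1}(subrKA w) ler_rnormD. Qed.

End zmodule.

Lemma rnormM (x y : R[i]) : rnorm (x * y) = rnorm x * rnorm y.
Proof. by apply: complexI; rewrite rmorphM/= -!rnormE normrM. Qed.

Lemma rnorm_real (x : R) : 0 <= x -> rnorm x%:C = x.
Proof. by move=> x0; apply: complexI; rewrite -rnormE ger0_norm// lecR. Qed.

Lemma rnormX (x : R[i]) n : rnorm (x ^+ n) = rnorm x ^+ n.
Proof. by apply: complexI; rewrite rmorphXn/= -!rnormE normrX. Qed.

Lemma rnorm1 : rnorm (1 : R[i]) = 1.
Proof. by apply: complexI; rewrite -rnormE normr1. Qed.

Lemma rnormZ (V : normedModType R[i]) (k : R[i]) (v : V) :
  rnorm (k *: v) = rnorm k * rnorm v.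
Proof. by apply: complexI; rewrite rmorphM/= -!rnormE normrZ. Qed.

Lemma rcvgP (V : normedModType R[i]) (T : Type) (F : set_system T)
    (FF : Filter F) (f : T -> V) (l : V) :
  f @ F --> l <-> forall e : R, 0 < e -> \forall t \near F, rnorm (l - f t) < e.
Proof.
split=> [/cvgrPdist_lt fl e e0|fl].
  have e0' : 0 < e%:C by rewrite ltcR.
  by apply: filterS (fl _ e0') => t; rewrite rnormE ltcR.
apply/cvgrPdist_lt => e e0.
have eE : e = (complex.Re e)%:C by rewrite RRe_real// gtr0_real.
have e0' : 0 < complex.Re e by rewrite -ltcR -eE.
by apply: filterS (fl _ e0') => t; rewrite rnormE eE ltcR.
Qed.

Lemma rnbhsP (V : normedModType R[i]) (v : V) (U : set V) :
  nbhs v U <-> exists2 e : R, 0 < e & forall w, rnorm (v - w) < e -> U w.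
Proof.
split=> [/nbhs_ballP[e /= e0 eU]|[e e0 eU]].
  have eE : e = (complex.Re e)%:C by rewrite RRe_real// gtr0_real.
  exists (complex.Re e) => [|w vw]; first by rewrite -ltcR -eE.
  by apply: eU; rewrite -ball_normE/= rnormE eE ltcR.
apply/nbhs_ballP; exists e%:C => /=; first by rewrite ltcR.
by move=> w; rewrite -ball_normE/= rnormE ltcR => /eU.
Qed.

Lemma half_powers_lt (c e : R) : 0 < e -> exists n, c / 2 ^+ n < e.
Proof.
move=> e0; have [|n _ /(_ n (leqnn _))] := proj1 (@cvgrPdist_lt _ _ _ _ _ _ 0)
  (@cvg_geometric R c (2^-1) _) e e0.
  by rewrite gtr0_norm ?invr_gt0// invf_lt1// ltr1n.
rewrite /= sub0r normrN exprVn => h; exists n; apply: le_lt_trans h.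
by rewrite ler_norm.
Qed.

(** Completeness in the form shared by the Neumann series, the nested balls, the successive
    approximations and the gliding hump. *)
Lemma cvg_half_steps (V : completeNormedModType R[i]) (u : nat -> V) (c : R) :
    (forall n, rnorm (u n.+1 - u n) <= c / 2 ^+ n) ->
  exists2 l : V, u @ \oo --> l & forall n, rnorm (l - u n) <= 2 * c / 2 ^+ n.
Proof.
move=> uc.
(* The exact geometric partial sum lets the induction close with equality. *)
have tail n k : rnorm (u (n + k)%N - u n) <= 2 * c / 2 ^+ n * (1 - (2 ^+ k)^-1).
  elim: k => [|k IH]; first by rewrite addn0 !subrr rnorm0 invr1 subrr mulr0.
  apply: le_trans (ler_rdistD (u (n + k)%N) _ _) _; rewrite addnS.
  apply: le_trans (lerD (uc _) IH) _.
  rewrite exprD exprS le_eqVlt; apply/orP; left; apply/eqP; field.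
  by rewrite !expf_neq0.
have c0 : 0 <= c.
  by have := le_trans (rnorm_ge0 _) (uc 0%N); rewrite expr0 divr1.
have tail' n m : (n <= m)%N -> rnorm (u m - u n) <= 2 * c / 2 ^+ n.
  move=> /subnKC <-; apply: le_trans (tail _ _) _; rewrite ler_piMr//.
  by rewrite divr_ge0 ?mulr_ge0 ?exprn_ge0.
have : cvg (u @ \oo).
  apply: cauchy_cvg; apply/cauchy_exP => e e0.
  have eE : e = (complex.Re e)%:C by rewrite RRe_real// gtr0_real.
  have e0' : 0 < complex.Re e by rewrite -ltcR -eE.
  have [n ne] := half_powers_lt (2 * c) e0'.
  exists (u n); exists n => // m /= nm; rewrite -ball_normE/=.
  by rewrite distrC rnormE eE ltcR (le_lt_trans (tail' _ _ nm)).
case/cvg_ex => l ul; exists l => // n; apply/ler_addgt0Pr => e e0.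
have [m _ /(_ (m + n)%N (leq_addr _ _))/= um] := (rcvgP _ _ _).1 ul e e0.
apply: le_trans (ler_rdistD (u (m + n)%N) _ _) _.
by rewrite addrC lerD ?tail' ?leq_addl// ltW.
Qed.

End real_norm.

(** * Inversion near the unit *)

Section banach_algebra.
Variables (R : realType) (A : comBanachAlgType R[i]).
Implicit Types a b : A.

Lemma ler_rnormM a b : rnorm (a * b) <= rnorm a * rnorm b.
Proof. by rewrite -lecR rmorphM/= -!rnormE banach_ler_normM. Qed.

Lemma banachZAr (k : R[i]) a b : k *: (a * b) = a * (k *: b).
Proof. by rewrite mulrC banachZAl mulrC. Qed.

(** Neumann series in d = 1 - a. The radius 1/2 is what [cvg_half_steps] can handle; the norm of 1
    is not normalised, hence its appearance in [dX]. *)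
Lemma neumann_half a : rnorm (1 - a) <= 2^-1 -> exists b, a * b = 1.
Proof.
move=> a1; pose d := 1 - a; pose u n : A := \sum_(k < n) d ^+ k.
have dX n : rnorm (d ^+ n) <= rnorm (1 : A) / 2 ^+ n.
  elim: n => [|n IH]; first by rewrite !expr0 invr1 mulr1.
  rewrite exprSr (le_trans (ler_rnormM _ _))// exprSr invfM mulrA.
  by rewrite ler_pM ?rnorm_ge0.
have [|l ul lu] := @cvg_half_steps _ _ u (rnorm (1 : A)).
  by move=> n; rewrite /u big_ord_recr/= addrAC subrr add0r.
exists l; apply/eqP; rewrite -subr_eq0; apply/eqP/rnorm_eq0.
have au n : a * u n = 1 - d ^+ n.
  have -> : a = 1 - d by rewrite /d opprB addrC subrK.
  elim: n => [|n IH]; first by rewrite /u big_ord0 mulr0 expr0 subrr.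
  by rewrite /u big_ord_recr/= mulrDr -/(u n) IH exprS; ring.
apply/eqP; rewrite eq_le rnorm_ge0 andbT; apply/ler_addgt0Pr => e e0.
rewrite add0r.
have [n ne] := half_powers_lt ((2 * rnorm a + 1) * rnorm (1 : A)) e0.
have -> : a * l - 1 = a * (l - u n) - d ^+ n by rewrite mulrBr au; ring.
apply: le_trans (ltW ne); apply: le_trans (ler_rnormB _ _) _.
rewrite mulrDl mul1r mulrDl lerD//.
apply: le_trans (ler_rnormM _ _) _.
by rewrite [2 * _]mulrC -!mulrA ler_wpM2l ?rnorm_ge0// mulrA lu.
Qed.

End banach_algebra.

(** If [P K] failed, the sets whose complement in [K] satisfies [P] would form a proper filter
    containing [K]. At a cluster point, the local hypothesis puts the complement of a neighbourhood
    into that filter. *)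
Lemma compact_induction (T : topologicalType) (K : set T) (P : set T -> Prop) :
    compact K -> P set0 -> (forall A B, A `<=` B -> P B -> P A) ->
    (forall A B, P A -> P B -> P (A `|` B)) ->
    (forall x, K x -> exists2 U, nbhs x U & P U) ->
  P K.
Proof.
move=> cK P0 Psub PU Ploc; apply: contrapT => nPK.
pose F : set_system T := [set S | P (K `\` S)].
have FF : ProperFilter F.
  split; first by rewrite /F/= setD0.
  split=> [|A B PA PB|A B AB PA]; first by rewrite /F/= setDT.
  - by rewrite /F/= setDIr; exact: PU.
  - by apply: Psub PA => x [Kx nB]; split=> // /AB.
have [|x [Kx Fx]] := cK F FF; first by rewrite /F/= setDv.
have [U xU PU'] := Ploc x Kx.
have [|y []//] := Fx (~` U) U _ xU.
by apply: Psub PU' => y [_ /contrapT].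
Qed.

(** * The closed graph theorem *)

Section closed_graph.
Local Open Scope complex_scope.
Variables (R : realType) (V W : completeNormedModType R[i]).
Variable T : {linear V -> W}.

(** Baire's argument: otherwise there are nested balls, the one of index n + 1 avoiding the points
    whose image has norm at most n, and their common point has no admissible image. *)
Let sublevel_dense_in_ball : exists (n : nat) (x : V) (r : R), 0 < r /\
  forall y, rnorm (x - y) < r -> forall e : R, 0 < e ->
    exists z, rnorm (y - z) < e /\ rnorm (T z) <= n%:R.
Proof.
apply: contrapT => nP.
have step (p : nat * (V * R)) : exists q : V * R, 0 < p.2.2 ->
    [/\ 0 < q.2, q.2 <= p.2.2 / 2, rnorm (q.1 - p.2.1) <= p.2.2 / 2 &
        forall z, rnorm (q.1 - z) <= q.2 -> p.1%:R < rnorm (T z)].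
  case: p => n [x r] /=; have [r0|/negP] := boolP (0 < r);
    last by exists (x, r).
  apply: contrapT => nq; apply: nP; exists n, x, (r / 2).
  split=> [|y xy e e0]; first exact: divr_gt0.
  apply: contrapT => nz; apply: nq.
  exists (y, Order.min (e / 2) (r / 2)) => _ /=.
  split; first by rewrite lt_min !divr_gt0.
  - by rewrite ge_min lexx orbT.
  - by rewrite rdistC ltW.
  move=> z; rewrite le_min => /andP[ye _]; rewrite ltNge; apply/negP => Tz.
  by apply: nz; exists z; split=> //; apply: le_lt_trans ye _; lra.
have [next nextP] := choice step.
pose s := fix s n : V * R := if n is m.+1 then next (m, s m) else (0, 1).
have s0 n : 0 < (s n).2.
  by elim: n => [|n IH] //=; have [] := nextP (n, s n) IH.
have sS n := nextP (n, s n) (s0 n).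
(* Centres move by at most half a radius and radii at least halve, so the difference of radii
   telescopes. *)
have nested n k :
    rnorm ((s (n + k)%N).1 - (s n).1) <= (s n).2 - (s (n + k)%N).2.
  elim: k => [|k IH]; first by rewrite addn0 !subrr rnorm0.
  have [_ /= a b _] := sS (n + k)%N.
  apply: le_trans (ler_rdistD (s (n + k)%N).1 _ _) _.
  by rewrite addnS /=; lra.
have s2 n : (s n).2 <= 1 / 2 ^+ n.
  elim: n => [|n IH]; first by rewrite expr0 divr1.
  have [_ /= a _ _] := sS n; apply: le_trans a _.
  by rewrite exprSr invfM mulrA ler_pM2r ?invr_gt0.
have [|l sl _] := @cvg_half_steps _ _ (fun n => (s n).1) 1.
  move=> n; apply: le_trans (s2 n); have := nested n 1%N; rewrite addn1.
  by move/le_trans; apply; rewrite gerBl ltW.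
have ls n : rnorm ((s n).1 - l) <= (s n).2.
  apply/ler_addgt0Pr => e e0.
  have [m _ /(_ (n + m)%N (leq_addl _ _))/= um] := (rcvgP _ _ _).1 sl e e0.
  rewrite rdistC; apply: le_trans (ler_rdistD (s (n + m)%N).1 _ _) _.
  rewrite addrC lerD ?(ltW um)//; apply: le_trans (nested n m) _.
  by rewrite gerBl ltW.
set n := (Num.truncn (rnorm (T l))).+1.
have [_ _ _ /(_ l (ls n.+1))] := sS n.
by rewrite /= ltNge ltW// truncnS_gt.
Qed.

(** Both x and a small multiple of f added to x are approximated from the sublevel set; by linearity
    the difference of the approximants serves for f. *)
Let approximation : exists2 M : R, 0 <= M & forall f : V,
  exists z, rnorm (f - z) <= rnorm f / 2 /\ rnorm (T z) <= M * rnorm f.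
Proof.
have [n [x [r [r0 nxr]]]] := sublevel_dense_in_ball.
exists (4 * n%:R / r); first by rewrite divr_ge0 ?mulr_ge0// ltW.
move=> f; have [->|/eqP f0] := eqVneq f 0.
  by exists 0; rewrite subr0 !linear0 !rnorm0 mul0r mulr0.
have nf0 : 0 < rnorm f.
  by rewrite lt_def rnorm_ge0 andbT; apply/eqP => /rnorm_eq0.
(* Now k f has norm r / 2, so x + k f stays in the ball, and two errors of r / 8 add up to half of
   that norm. *)
pose k : R := r / (2 * rnorm f); have k0 : 0 < k by rewrite divr_gt0 ?mulr_gt0.
have r40 : 0 < r / 8 by rewrite divr_gt0.
have [|z1 [xz1 Tz1]] := nxr (x + k%:C *: f) _ _ r40.
  rewrite opprD addNKr rnormN rnormZ rnorm_real ?(ltW k0)//.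
  rewrite /k (_ : _ * _ = r / 2); last by field; rewrite gt_eqF.
  lra.
have [|z2 [xz2 Tz2]] := nxr x _ _ r40; first by rewrite subrr rnorm0.
exists (k^-1%:C *: (z1 - z2)).
have kV0 : 0 <= k^-1 by rewrite invr_ge0 ltW.
split.
  rewrite (_ : f - _ = k^-1%:C *: ((x + k%:C *: f - z1) - (x - z2))).
    rewrite rnormZ rnorm_real//.
    rewrite (_ : _ / 2 = k^-1 * (r / 4)); last first.
      by rewrite /k; field; rewrite !gt_eqF.
    rewrite ler_wpM2l//; apply: le_trans (ler_rnormB _ _) _; lra.
  have -> : x + k%:C *: f - z1 - (x - z2) = k%:C *: f - (z1 - z2).
    rewrite opprB -[x + _ - _]addrA addrC addrACA subrr addr0.
    by rewrite opprB addrA addrAC.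
  rewrite [RHS]scalerBr scalerA -rmorphM/= mulVf ?gt_eqF// scale1r.
  by [].
rewrite linearZ/= rnormZ rnorm_real// linearB/=.
rewrite (_ : _ * rnorm f = k^-1 * (2 * n%:R)); last first.
  by rewrite /k; field; rewrite !gt_eqF.
rewrite ler_wpM2l//; apply: le_trans (ler_rnormB _ _) _; lra.
Qed.

(** Applying [approximation] to successive remainders writes f as a series whose images are
    summable; closedness of the graph identifies the sum of the images with [T f]. *)
Lemma closed_graph_bounded :
    (forall f g, (forall e : R, 0 < e -> exists f',
        rnorm (f - f') < e /\ rnorm (g - T f') < e) -> T f = g) ->
  exists2 M : R, 0 <= M & forall f, rnorm (T f) <= M * rnorm f.
Proof.
move=> closedT; have [M M0 /choice[h hP]] := approximation.
exists (2 * M) => [|f]; first by rewrite mulr_ge0.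
pose d := fix d n := if n is m.+1 then d m - h (d m) else f.
have dn n : rnorm (d n) <= rnorm f / 2 ^+ n.
  elim: n => [|n IH]; first by rewrite expr0 divr1.
  have [/le_trans -> //] := hP (d n).
  by rewrite exprSr invfM mulrA ler_wpM2r.
have [|g Sg gS] := @cvg_half_steps _ _ (fun n => T (f - d n)) (M * rnorm f).
  move=> n; rewrite -linearB /= (_ : _ - _ - _ = h (d n)).
    have [_ /le_trans -> //] := hP (d n).
    by rewrite -mulrA ler_wpM2l.
  by rewrite !opprB [f + _]addrC addrACA subrr addr0 subrK.
have <- : g = T f.
  apply/esym/closedT => e e0.
  have [m _ mg] := (rcvgP _ _ _).1 Sg e e0.
  have [n ne] := half_powers_lt (rnorm f) e0.
  exists (f - d (m + n)%N); split; last exact: (mg (m + n)%N (leq_addr _ _)).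
  rewrite opprB addrC subrK; apply: le_lt_trans ne; apply: le_trans (dn _) _.
  by rewrite ler_wpM2l ?rnorm_ge0// lef_pV2 ?posrE ?exprn_gt0// ler_eXn2l
    ?leq_addl// ltr1n.
by have := gS 0%N; rewrite /= subrr linear0 subr0 expr0 divr1 mulrA.
Qed.

End closed_graph.

Lemma bound_continuous (R : realType) (V W : normedModType R[i])
    (T : {linear V -> W}) (M : R) :
  0 <= M -> (forall v, rnorm (T v) <= M * rnorm v) -> continuous T.
Proof.
move=> M0 TM v; apply/rcvgP => e e0; have M1 : 0 < M + 1 by lra.
have d0 : 0 < e / (M + 1) by rewrite divr_gt0.
have ve : nbhs v [set w | rnorm (v - w) < e / (M + 1)].
  by apply/rnbhsP; exists (e / (M + 1)).
apply: filterS ve => w vw; rewrite -linearB; apply: le_lt_trans (TM _) _.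
have := ler_wpM2l M0 (ltW vw).
have : e = (M + 1) * (e / (M + 1)) by field; rewrite gt_eqF.
lra.
Qed.

(** * Ideals and roots of unity *)

Section ideals.
Variables (R : realType) (A : comBanachAlgType R[i]).
Implicit Types (a b m : A) (I : set A).

Definition is_ideal I :=
  [/\ I 0, forall a b, I a -> I b -> I (a + b) & forall a b, I a -> I (a * b)].

Lemma idealN I a : is_ideal I -> I a -> I (- a).
Proof. by move=> [_ _ IM] Ia; rewrite -mulrN1; exact: IM. Qed.

Lemma idealB I a b : is_ideal I -> I a -> I b -> I (a - b).
Proof.
by move=> II Ia Ib; have [_ ID _] := II; apply: ID Ia (idealN II Ib).
Qed.

Lemma ideal_sum I n (u : nat -> A) : is_ideal I -> (forall j, I (u j)) ->
  I (\sum_(j < n) u j).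
Proof.
move=> [I0 ID _] Iu; elim: n => [|n IH]; first by rewrite big_ord0.
by rewrite big_ord_recr; exact: ID.
Qed.

Lemma idealZ I (k : R[i]) a : is_ideal I -> I a -> I (k *: a).
Proof.
by move=> [_ _ IM] Ia; rewrite -[a]mulr1 banachZAr; exact: IM.
Qed.

Lemma maximal_ideal_exists I : is_ideal I -> ~ I 1 ->
  exists M, [/\ I `<=` M, is_ideal M, ~ M 1 &
    forall a, ~ M a -> exists b, M (a * b - 1)].
Proof.
(* [Zorn_bigcup] also quantifies over the empty chain; joining [I] to every set makes the empty
   union stand for [I]. *)
move=> II nI1; pose P S := is_ideal (I `|` S) /\ ~ (I `|` S) 1.
have [|S [[PS nS1] maxS]] := @Zorn_bigcup A P.
  move=> F FP Ftot.
  have PC S : S = set0 \/ F S -> P S.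
    by case=> [->|/FP//]; rewrite /P setU0.
  have Cbig S : S = set0 \/ F S -> I `|` S `<=` I `|` \bigcup_(X in F) X.
    by case=> [-> x|FS x] [Ix|//]; [left|left|right; exists S].
  have pick x : (I `|` \bigcup_(X in F) X) x ->
      exists2 S, S = set0 \/ F S & (I `|` S) x.
    by case=> [Ix|[S FS Sx]]; [exists set0; left|exists S; right].
  have pick2 x y : (I `|` \bigcup_(X in F) X) x ->
      (I `|` \bigcup_(X in F) X) y ->
      exists S, [/\ S = set0 \/ F S, (I `|` S) x & (I `|` S) y].
    move=> /pick[S1 FS1 S1x] /pick[S2 FS2 S2y].
    have [S12|S21] : S1 `<=` S2 \/ S2 `<=` S1.
      case: FS1 => [->|F1]; first by left.
      by case: FS2 => [->|F2]; [right|exact: Ftot].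
    - by exists S2; split=> //; case: S1x => [|/S12]; [left|right].
    - by exists S1; split=> //; case: S2y => [|/S21]; [left|right].
  split; last by move=> /pick[S /PC[]].
  split; first by left; have [] := II.
  - move=> a b Ca Cb; have [S [FS Sa Sb]] := pick2 _ _ Ca Cb.
    by apply: (Cbig _ FS); have [[_ ID _] _] := PC _ FS; exact: ID.
  - move=> a b /pick[S FS Sa].
    by apply: (Cbig _ FS); have [[_ _ IM] _] := PC _ FS; exact: IM.
set M := I `|` S in PS nS1; exists M; split=> //; first by move=> x; left.
move=> a Ma; have [M0 MD MM] := PS.
pose J := [set x | exists2 m, M m & exists b, x = m + a * b].
have MJ : M `<=` J.
  by move=> m Mm; exists m => //; exists 0; rewrite mulr0 addr0.
have Ja : J a by exists 0 => //; exists 1; rewrite mulr1 add0r.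
have SJ : S `<` J.
  split=> [|JS]; first by move=> x Sx; apply: MJ; right.
  by apply: Ma; right; exact: JS.
have IJ : I `|` J = J by apply/setUidPr => x Ix; apply: MJ; left.
have JI : is_ideal J.
  split; first exact: MJ.
  - move=> _ _ [m1 Mm1 [b1 ->]] [m2 Mm2 [b2 ->]].
    exists (m1 + m2); first exact: MD.
    by exists (b1 + b2); ring.
  - move=> _ c [m Mm [b ->]]; exists (m * c); first exact: MM.
    by exists (b * c); ring.
have [m Mm [b abm]] : J 1.
  by apply: contrapT => nJ1; apply: (maxS J SJ); rewrite /P IJ.
exists b; rewrite (_ : _ - _ = - m); first exact: idealN.
by rewrite abm; ring.
Qed.

End ideals.

Section primitive_roots.
Variable F : closedFieldType.

(** X^n - 1 splits and is separable, so it has n distinct roots, and a finite group of roots of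
    unity is cyclic. *)
Lemma prim_root_exists n : (0 < n)%N -> (n%:R != 0 :> F) ->
  exists z : F, n.-primitive_root z.
Proof.
move=> n0 nF0; pose p : {poly F} := 'X^n - 1.
have [r Dp] := closed_field_poly_normal p.
rewrite (monicP _) ?monicXnsubC // scale1r in Dp.
have rn1 : all n.-unity_root r by apply/allP=> z; rewrite -root_prod_XsubC -Dp.
have sz_r : (n < (size r).+1)%N.
  by rewrite -(size_prod_XsubC r id) -Dp size_XnsubC.
have [|z] := hasP (has_prim_root n0 rn1 _ sz_r); last by exists z.
by rewrite -separable_prod_XsubC -Dp separable_Xn_sub_1.
Qed.

End primitive_roots.

(** Orthogonality: for k nonzero, multiplying by the nonzero [w ^+ k - 1] makes the sum telescope to
    0. *)
Lemma sum_prim_root_powers (F : fieldType) (n k : nat) (w : F) :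
    n.-primitive_root w -> (k < n)%N ->
  \sum_(j < n) w ^+ (j * k) = (if k == 0%N then n%:R else 0).
Proof.
move=> wn kn; have [->|k0] := eqVneq k 0%N.
  under eq_bigr do rewrite muln0 expr0.
  by rewrite sumr_const card_ord.
apply: (mulfI (_ : w ^+ k - 1 != 0)).
  rewrite subr_eq0 -(prim_order_dvd wn) gtnNdvd// lt0n//.
under eq_bigr do rewrite mulnC exprM.
by rewrite -subrX1 mulr0 -exprM mulnC exprM (prim_expr_order wn) expr1n subrr.
Qed.

(** * The Gelfand-Mazur theorem *)

Section ideal_distance.
Variables (R : realType) (A : comBanachAlgType R[i]) (M : set A).
Hypothesis idealM : is_ideal M.
Implicit Types a b m : A.

(* The quotient seminorm of A / M, so that no quotient algebra is needed. *)
Definition idist a : R := inf [set rnorm (a - m) | m in M].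

Let idist_nonempty a : [set rnorm (a - m) | m in M] !=set0.
Proof. by have [M0 _ _] := idealM; exists (rnorm (a - 0)), 0. Qed.

Lemma idist_le a m : M m -> idist a <= rnorm (a - m).
Proof.
move=> Mm; apply: ge_inf; last by exists m.
by exists 0 => _ [n _ <-]; exact: rnorm_ge0.
Qed.

Lemma idist_ge0 a : 0 <= idist a.
Proof. by apply: lb_le_inf => // _ [n _ <-]; exact: rnorm_ge0. Qed.

Lemma idist_near a (e : R) : 0 < e ->
  exists2 m, M m & rnorm (a - m) < idist a + e.
Proof.
move=> e0; have hi : has_inf [set rnorm (a - m) | m in M].
  by split; [exact: idist_nonempty|exists 0 => _ [n _ <-]; exact: rnorm_ge0].
by have [_ [m Mm <-] ?] := inf_adherent e0 hi; exists m.
Qed.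

Lemma idist_mem m : M m -> idist m = 0.
Proof.
move=> Mm; apply/eqP; rewrite eq_le idist_ge0 andbT.
by have := idist_le m Mm; rewrite subrr rnorm0.
Qed.

Lemma idistD a b : idist (a + b) <= idist a + idist b.
Proof.
apply/ler_addgt0Pr => e e0; have e2 : 0 < e / 2 by rewrite divr_gt0.
have [m Mm am] := idist_near a e2; have [n Mn bn] := idist_near b e2.
have [_ MD _] := idealM; apply: le_trans (idist_le _ (MD _ _ Mm Mn)) _.
rewrite opprD addrACA; apply: le_trans (ler_rnormD _ _) _; lra.
Qed.

Lemma idist_congr a b : M (a - b) -> idist a = idist b.
Proof.
move=> Mab; have le x y : M (x - y) -> idist x <= idist y.
  move=> Mxy; rewrite -[leLHS]/(idist x) -(subrK y x).
  by rewrite (le_trans (idistD _ _))// idist_mem// add0r.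
by apply/eqP; rewrite eq_le !le// -opprB; exact: idealN.
Qed.

Lemma idistM a b : idist (a * b) <= idist a * idist b.
Proof.
have [_ MD MM] := idealM.
have step (e : R) : 0 < e -> idist (a * b) <= (idist a + e) * (idist b + e).
  move=> e0; have [m Mm am] := idist_near a e0.
  have [n Mn bn] := idist_near b e0.
  have Mmn : M (a * n + m * (b - n)).
    by apply: MD; [rewrite mulrC|]; exact: MM.
  apply: le_trans (idist_le _ Mmn) _.
  rewrite (_ : _ - _ = (a - m) * (b - n)); last by ring.
  by apply: le_trans (ler_rnormM _ _) _; rewrite ler_pM ?rnorm_ge0// ltW.
apply/ler_addgt0Pr => e e0.
have a0 := idist_ge0 a; have b0 := idist_ge0 b.
set s := idist a in a0 *; set t := idist b in b0 *.
(* (s + d) (t + d) exceeds s t by d (s + t + d), which is at most d (s + t + 1) when d is at most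
   1. *)
pose d := Order.min 1 (e / (s + t + 1)).
have st0 : 0 < s + t + 1 by lra.
have d0 : 0 < d by rewrite lt_min ltr01 divr_gt0.
apply: le_trans (step d d0) _; rewrite -/s -/t.
have d1 : d <= 1 by rewrite ge_min lexx.
have : d * (s + t + 1) <= e.
  by rewrite -ler_pdivlMr// ge_min lexx orbT.
by nra.
Qed.

Lemma idistZ (k : R[i]) a : idist (k *: a) <= rnorm k * idist a.
Proof.
apply/ler_addgt0Pr => e e0.
have k1 : 0 < rnorm k + 1 by have := rnorm_ge0 k; lra.
have [m Mm am] := idist_near a (divr_gt0 e0 k1).
apply: le_trans (idist_le _ (idealZ k idealM Mm)) _.
rewrite -scalerBr rnormZ.
apply: (@le_trans _ _ (rnorm k * (idist a + e / (rnorm k + 1)))).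
  by rewrite ler_wpM2l ?rnorm_ge0// ltW.
rewrite mulrDr lerD2l mulrCA ler_piMr ?ltW// ltr_pdivrMr//; lra.
Qed.

Lemma idistN a : idist (- a) <= idist a.
Proof.
by rewrite -scaleN1r (le_trans (idistZ _ _))// /rnorm normrN1/= mul1r.
Qed.

Lemma idistB a b : idist (a - b) <= idist a + idist b.
Proof. by rewrite (le_trans (idistD _ _))// lerD2l idistN. Qed.

Lemma idist_sum n (u : nat -> A) :
  idist (\sum_(j < n) u j) <= \sum_(j < n) idist (u j).
Proof.
elim: n => [|n IH]; first by rewrite !big_ord0 idist_mem//; have [] := idealM.
by rewrite !big_ord_recr/= (le_trans (idistD _ _))// lerD2r.
Qed.

(** An element of [M] within 1/2 of 1 would be invertible. This keeps the quotient seminorm of 1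
    away from 0, which the final contradiction needs. *)
Lemma idist1_ge : ~ M 1 -> 2^-1 <= idist 1.
Proof.
move=> nM1; rewrite leNgt; apply/negP => d1; apply: nM1.
have [m Mm m1] : exists2 m, M m & rnorm (1 - m) <= 2^-1.
  have [|m Mm m1] := @idist_near 1 (2^-1 - idist 1); first by rewrite subr_gt0.
  by exists m => //; lra.
by have [b <-] := neumann_half m1; have [_ _ MM] := idealM; exact: MM.
Qed.

End ideal_distance.

Section complex_plane.
Variable R : realType.

Lemma rnorm_rect (a b : R) : rnorm (a +i* b)%C <= `|a| + `|b|.
Proof.
rewrite /rnorm normc_def/= -(ger0_norm (addr_ge0 (normr_ge0 a) (normr_ge0 b))).
rewrite -sqrtr_sqr ler_wsqrtr//= -(real_normK (num_real a)).
rewrite -(real_normK (num_real b)).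
have := normr_ge0 a; have := normr_ge0 b; nra.
Qed.

Lemma ler_norm_rnorm (z : R[i]) :
  `|complex.Re z| <= rnorm z /\ `|complex.Im z| <= rnorm z.
Proof.
case: z => a b; rewrite /rnorm normc_def/=; split.
  by rewrite -sqrtr_sqr ler_wsqrtr// lerDl sqr_ge0.
by rewrite -sqrtr_sqr ler_wsqrtr// lerDr sqr_ge0.
Qed.

Lemma complex_disc_compact (r : R) : compact [set z : R[i]^o | rnorm z <= r].
Proof.
pose h (p : R * R) : R[i]^o := (p.1 +i* p.2)%C.
have hc : continuous h.
  move=> [a b]; apply/rcvgP => e e0; have e2 : 0 < e / 2 by rewrite divr_gt0.
  exists (ball a (e / 2), ball b (e / 2)) => [|[c d] [/= ac bd]].
    by split; exact: nbhsx_ballx.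
  apply: (@le_lt_trans _ _ (`|a - c| + `|b - d|)); first exact: rnorm_rect.
  move: ac bd; rewrite /ball/=; lra.
have cr : compact [set x : R | -r <= x <= r].
  by rewrite -[X in compact X]set_itvcc; exact: segment_compact.
apply: (subclosed_compact _
  (continuous_compact (continuous_subspaceT hc) (compact_setX cr cr))).
  move=> z zc; rewrite /= leNgt; apply/negP => rz.
  have zr : nbhs z [set w : R[i]^o | rnorm (z - w) < rnorm z - r].
    by apply/rnbhsP; exists (rnorm z - r) => //; rewrite subr_gt0.
  have [w [/= wr]] := zc _ zr.
  have := ler_rnormD (z - w) w; rewrite subrK; lra.
move=> [a b] /= zr; exists (a, b) => //=.
have [/= + +] := ler_norm_rnorm (a +i* b)%C.
by move=> /le_trans/(_ zr) + /le_trans/(_ zr); rewrite !ler_norml.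
Qed.

End complex_plane.

Section gelfand_mazur.
Variables (R : realType) (A : comBanachAlgType R[i]) (M : set A).
Hypotheses (idealM : is_ideal M) (nM1 : ~ M 1).
Local Notation q := (idist M).
Implicit Types (x y : A) (z w : R[i]).

(** Scalars as elements of [A], so that [ring] can treat identities mixing scaling and products. *)
Let sc z : A := z *: (1 : A).

Let scE z x : z *: x = sc z * x.
Proof. by rewrite /sc -banachZAl mul1r. Qed.

Let scM z w : sc (z * w) = sc z * sc w.
Proof. by rewrite /sc -scalerA [LHS]scE. Qed.

Let scB z w : sc (z - w) = sc z - sc w.
Proof. exact: scalerBl. Qed.

Let scX z n : sc (z ^+ n) = sc z ^+ n.
Proof.
by elim: n => [|n IH]; rewrite ?expr0 ?[sc 1]scale1r// !exprS scM IH.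
Qed.

Let M0 : M 0. Proof. by case: idealM. Qed.
Let MD x y : M x -> M y -> M (x + y).
Proof. by case: idealM => _ + _; exact. Qed.
Let MM x y : M x -> M (x * y). Proof. by case: idealM => _ _; exact. Qed.

Variable a : A.
Hypothesis inverse_mod : forall z, exists b, M ((a - z *: (1 : A)) * b - 1).

(** Inverting 1 - z a instead of a - z makes the resolvent 1 at z = 0 and, for small z, a geometric
    series in z a; for z nonzero, 1 - z a = - z (a - 1/z). *)
Let resolvent_exists z : exists S, M (S * (1 - z *: a) - 1).
Proof.
have [->|z0] := eqVneq z 0.
  by exists 1; rewrite scale0r subr0 mul1r subrr.
have [b Mb] := inverse_mod z^-1; exists (- z^-1 *: b).
suff -> : (- z^-1 *: b) * (1 - z *: a) - 1 = (a - z^-1 *: (1 : A)) * b - 1.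
  by [].
have zz : sc z^-1 * sc z = 1 by rewrite -scM mulVf// [LHS]scale1r.
rewrite scaleNr !scE mulr1.
transitivity ((sc z^-1 * sc z) * a * b - sc z^-1 * b - 1); first by ring.
by rewrite zz; ring.
Qed.

Let res z : A := projT1 (cid (resolvent_exists z)).
Let resP z : M (res z * (1 - z *: a) - 1).
Proof. exact: projT2 (cid (resolvent_exists z)). Qed.

Let res_eq z w : M (res z - res w - (z - w) *: (a * res z * res w)).
Proof.
have := MD (MM (res w) (resP z)) (idealN idealM (MM (res z) (resP w))).
congr M.
by rewrite !scE scB; ring.
Qed.

Let q0 x : 0 <= q x. Proof. exact: idist_ge0. Qed.

Let res_dist z w :
  q (res z - res w) <= rnorm (z - w) * (q a * q (res z) * q (res w)).
Proof.
rewrite (idist_congr idealM (res_eq z w)) (le_trans (idistZ idealM _ _))//.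
rewrite ler_wpM2l ?rnorm_ge0// (le_trans (idistM idealM _ _))//.
by rewrite ler_wpM2r// idistM.
Qed.

Let res_bounded (r : R) :
  exists2 B, 0 <= B & forall z, rnorm z <= r -> q (res z) <= B.
Proof.
pose P (S : set R[i]^o) := exists2 B, 0 <= B & forall z, S z -> q (res z) <= B.
suff : P [set z | rnorm z <= r] by [].
apply: compact_induction; first exact: complex_disc_compact.
- by exists 0.
- by move=> S U SU [B B0 UB]; exists B => // z /SU/UB.
- move=> S U [B B0 SB] [C C0 UC]; exists (B + C) => [|z [/SB|/UC]]; lra.
(* Within [d] of z the factor |w - z| q(a) q(res z) is at most 1/2, so [res_dist] absorbs half of
   q(res w) and leaves q(res w) <= 2 q(res z). *)
move=> z _; pose d := (2 * (q a * q (res z) + 1))^-1.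
have az : 0 <= q a * q (res z) by rewrite mulr_ge0.
have d0 : 0 < d by rewrite invr_gt0; lra.
exists [set w | rnorm (z - w) < d]; first by apply/rnbhsP; exists d.
exists (2 * q (res z)) => [|w /= zw]; first by rewrite mulr_ge0.
have h : q (res w) <= q (res z) + q (res w - res z).
  rewrite -{1}(subrK (res z) (res w)) addrC; exact: idistD.
have := res_dist w z.
have h2 : rnorm (w - z) * (q a * q (res z)) <= 2^-1.
  rewrite rdistC (le_trans (ler_wpM2r az (ltW zw)))//.
  by rewrite /d mulrC ler_pdivrMr; lra.
have := ler_wpM2r (q0 (res w)) h2; lra.
Qed.

Let res_lipschitz (r : R) : exists2 L, 0 <= L & forall z w,
  rnorm z <= r -> rnorm w <= r -> q (res z - res w) <= L * rnorm (z - w).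
Proof.
have [B B0 rB] := res_bounded r; exists (q a * B * B).
  by rewrite !mulr_ge0.
move=> z w zr wr; rewrite mulrC; apply: le_trans (res_dist z w) _.
by rewrite ler_wpM2l ?rnorm_ge0// !ler_pM ?mulr_ge0// ?rB// ler_wpM2l// rB.
Qed.

(* Averaging the resolvent over the n-th roots of unity inverts 1 - z^n a^n
   while keeping the Lipschitz constant of the resolvent. *)
Let mean_resolvent (r L : R) :
    (forall z w, rnorm z <= r -> rnorm w <= r ->
      q (res z - res w) <= L * rnorm (z - w)) ->
  forall n, (0 < n)%N -> exists S : R[i] -> A,
    (forall z, M (S z * (1 - z ^+ n *: a ^+ n) - 1)) /\
    (forall z w, rnorm z <= r -> rnorm w <= r ->
      q (S z - S w) <= L * rnorm (z - w)).
Proof.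
move=> lip n n0; have nF0 : (n%:R : R[i]) != 0 by rewrite pnatr_eq0 -lt0n.
have [zt prim_zt] := prim_root_exists n0 nF0.
have ro j : rnorm (zt ^+ j) = 1.
  suff zt1 : rnorm zt = 1 by rewrite rnormX zt1 expr1n.
  apply/eqP; rewrite -(pexpr_eq1 n0) ?rnorm_ge0// -rnormX.
  rewrite (prim_expr_order prim_zt).
  by rewrite rnorm1.
exists (fun z => n%:R^-1 *: \sum_(j < n) res (zt ^+ j * z)).
split=> [z|z w zr wr].
  (* With x = zt^j z a, the power x^n = z^n a^n does not depend on j, and 1 - x^n = (1 - x) [u j].
     Summed over j, the powers of exponent 1 to n - 1 cancel and only n remains. *)
  pose u j : A := \sum_(k < n) (zt ^+ j * z *: a) ^+ k.
  have geom j : M (res (zt ^+ j * z) * (1 - z ^+ n *: a ^+ n) - u j).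
    have -> : z ^+ n *: a ^+ n = (zt ^+ j * z *: a) ^+ n.
      rewrite !scE !exprMn -!scX exprMn -exprM mulnC exprM.
      by rewrite (prim_expr_order prim_zt) expr1n mul1r.
    rewrite -(opprB _ 1) subrX1 -mulNr opprB.
    by have := MM (u j) (resP (zt ^+ j * z)); congr M; rewrite -/(u j); ring.
  have sumu : \sum_(j < n) u j = n%:R *: (1 : A).
    rewrite exchange_big/=.
    transitivity (\sum_(k < n) (\sum_(j < n) zt ^+ (j * k)) *: (z *: a) ^+ k).
      apply: eq_bigr => k _; rewrite scaler_suml; apply: eq_bigr => j _.
      by rewrite -scalerA (scE (zt ^+ j)) exprMn -scX -exprM -scE.
    under eq_bigr do rewrite (sum_prim_root_powers prim_zt (ltn_ord _)).
    rewrite (bigD1 (Ordinal n0))//= expr0 big1 ?addr0// => k k0.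
    by rewrite ifF ?scale0r//; apply/negbTE; rewrite -lt0n lt0n.
  have := idealZ n%:R^-1 idealM (ideal_sum n idealM geom).
  congr M; rewrite sumrB sumu scalerBr scalerA mulVf// scale1r.
  by rewrite -mulr_suml banachZAl.
rewrite -scalerBr -sumrB; apply: le_trans (idistZ idealM _ _) _.
have -> : rnorm (n%:R^-1 : R[i]) = n%:R^-1.
  by rewrite -[n%:R](rmorph_nat (real_complex R)) -fmorphV/= rnorm_real.
rewrite mulrC ler_pdivrMr ?ltr0n//.
apply: le_trans (idist_sum idealM _
  (fun j => res (zt ^+ j * z) - res (zt ^+ j * w))) _.
have -> : L * rnorm (z - w) * n%:R = \sum_(j < n) L * rnorm (z - w).
  by rewrite sumr_const card_ord mulr_natr.
apply: ler_sum => j _; apply: le_trans (lip _ _ _ _) _.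
- by rewrite rnormM ro mul1r.
- by rewrite rnormM ro mul1r.
- by rewrite -mulrBr rnormM ro mul1r.
Qed.

(* Since 1 - t^n a^n has an inverse close to 1 exactly when t^n a^n is small,
   uniform continuity of the averaged resolvents propagates this property by
   steps of a fixed length, hence to every t up to r.  For t beyond the norm of
   an inverse of a it is absurd. *)
Let vanishing (t : R) := forall e : R, 0 < e -> exists N, forall n,
  (N <= n)%N -> q (t%:C ^+ n *: a ^+ n)%C < e.

Let vanishing0 : vanishing 0.
Proof.
move=> e e0; exists 1%N => n n1.
by rewrite expr0n gtn_eqF// scale0r idist_mem.
Qed.

Let absorb (s p : R) : s <= 2^-1 -> 0 <= p -> p <= s + s * p -> p <= 1.
Proof. by nra. Qed.

(** At t the averaged resolvent is within 1/4 of 1, hence within 1/2 at t + d, which only bounds (t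
    + d)^n a^n by 1. Stopping at t + d / 2 turns this bound into geometric decay with ratio
    [rho]. *)
Let vanishing_step (r L d t : R) : (forall z w, rnorm z <= r -> rnorm w <= r ->
      q (res z - res w) <= L * rnorm (z - w)) -> 0 < d -> L * d <= 4^-1 ->
  0 <= t -> t + d <= r -> vanishing t -> vanishing (t + d / 2).
Proof.
move=> lip d0 Ld t0 tdr vt e e0; pose Q := q 1.
have Q0 : 0 <= Q by exact: q0.
(* With v = q(w) at most 1 / (8 (Q + 1)), the inequality s <= (s + Q) v for s = q(S t - 1) gives s
   <= 1/7. *)
have [N1 vN1] : exists N, forall n, (N <= n)%N ->
    q (t%:C ^+ n *: a ^+ n)%C < (8 * (Q + 1))^-1.
  by apply: vt; rewrite invr_gt0; lra.
pose rho := (t + d / 2) / (t + d).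
have td0 : 0 < t + d by lra.
have rhoE : rho * (t + d) = t + d / 2 by rewrite /rho divfK// gt_eqF.
have rho0 : 0 <= rho by rewrite /rho divr_ge0//; lra.
have rho1 : `|rho| < 1 by rewrite ger0_norm// /rho ltr_pdivrMr; lra.
have [N2 _ vN2] := (cvgrPdist_lt _ _).1 (cvg_geometric 1 rho1) e e0.
(* The successor keeps n positive, as averaging over n roots requires. *)
exists (maxn N1 N2).+1 => n nN.
have n0 : (0 < n)%N by apply: leq_trans nN.
have nN1 : (N1 <= n)%N by apply: leq_trans (ltnW nN); exact: leq_maxl.
have nN2 : (N2 <= n)%N by apply: leq_trans (ltnW nN); exact: leq_maxr.
have [S [SP Slip]] := mean_resolvent lip n0.
have := vN1 n nN1; set w := (t%:C ^+ n *: a ^+ n)%C => qw.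
pose w' := ((t + d)%:C ^+ n *: a ^+ n)%C.
have S1 : q (S t%:C%C - 1) <= 4^-1.
  have : q (S t%:C%C - 1) <= (q (S t%:C%C - 1) + Q) * q w.
    rewrite [leLHS](@idist_congr _ _ _ idealM _ (S t%:C%C * w)).
      apply: le_trans (idistM idealM _ _) _; rewrite ler_wpM2r//.
      by have := idistD idealM (S t%:C%C - 1) 1; rewrite subrK.
    by have := SP t%:C%C; congr M; rewrite -/w; ring.
  have : q w * (8 * (Q + 1)) <= 1.
    by rewrite -ler_pdivlMr; [rewrite mul1r ltW|lra].
  have := q0 w; have := q0 (S t%:C%C - 1).
  by set s := q (_ - 1); set v := q w; nra.
have S'1 : q (S (t + d)%:C%C - 1) <= 2^-1.
  have := idistD idealM (S (t + d)%:C%C - S t%:C%C) (S t%:C%C - 1).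
  rewrite subrKA; have := Slip (t + d)%:C%C t%:C%C.
  rewrite -rmorphB/= !rnorm_real; [|lra..].
  rewrite addrAC subrr add0r => /(_ _ _)/= h1.
  have {}h1 := h1 tdr (_ : t <= r); lra.
have qw' : q w' <= 1.
  have : q w' <= q (S (t + d)%:C%C - 1) + q (S (t + d)%:C%C - 1) * q w'.
    apply: le_trans (lerD (lexx _) (idistM idealM _ _)).
    apply: le_trans (idistB idealM _ _); rewrite le_eqVlt; apply/orP; left.
    apply/eqP/(idist_congr idealM).
    have := idealN idealM (SP (t + d)%:C%C); congr M; rewrite -/w'; ring.
  exact: absorb S'1 (q0 w').
have -> : (t + d / 2)%:C%C = rho%:C%C * (t + d)%:C%C.
  by rewrite -rmorphM/= rhoE.
rewrite exprMn -scalerA -/w'.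
apply: le_lt_trans (idistZ idealM _ _) _.
rewrite rnormX rnorm_real//.
have := vN2 n nN2; rewrite /= sub0r normrN ger0_norm ?mul1r ?exprn_ge0//.
apply: le_lt_trans.
by rewrite ler_piMr ?exprn_ge0.
Qed.

Lemma gelfand_mazur_contradiction : False.
Proof.
have [b Mab] := inverse_mod 0; rewrite scale0r subr0 in Mab.
(* Steps of length [d / 2] overshoot t by at most 1, and each step looks [d] ahead; r = t + 2 leaves
   room for both. *)
pose t := q b + 1; pose r := t + 2; pose Q := q 1.
have t1 : 1 <= t by rewrite /t; have := q0 b; lra.
have [L L0 lip] := res_lipschitz r.
pose d := (4 * (L + 1))^-1.
have d0 : 0 < d by rewrite invr_gt0; lra.
have Ld : L * d <= 4^-1 by rewrite /d ler_pdivrMr; lra.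
have d1 : d <= 4^-1 by rewrite /d lef_pV2 ?posrE; lra.
have vk (k : nat) : k%:R * (d / 2) <= t + 1 -> vanishing (k%:R * (d / 2)).
  elim: k => [_|k IH]; first by rewrite mul0r; exact: vanishing0.
  rewrite -natr1 mulrDl mul1r => kt.
  apply: (vanishing_step lip d0 Ld).
  - by rewrite mulr_ge0// divr_ge0// ltW.
  - by rewrite /r; lra.
  - by apply: IH; lra.
pose k := (Num.truncn (t / (d / 2))).+1.
have kt : t <= k%:R * (d / 2).
  by rewrite -ler_pdivrMr ?divr_gt0// ltW// truncnS_gt.
have kt1 : k%:R * (d / 2) <= t + 1.
  have : (Num.truncn (t / (d / 2)))%:R <= t / (d / 2).
    by rewrite truncn_le// divr_ge0//; lra.
  rewrite ler_pdivlMr ?divr_gt0// => kd.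
  by rewrite /k -natr1 mulrDl; lra.
have := vk k kt1; set s := k%:R * (d / 2) in kt kt1 * => vs.
have Q0 : 0 <= Q by exact: q0.
have e0 : 0 < (4 * (Q + 1))^-1 by rewrite invr_gt0; lra.
have [n /(_ n.+1 (leqnSn n)) qn] := vs _ e0.
have s0 : 0 < s by lra.
have Mabn j : M (a ^+ j * b ^+ j - 1).
  elim: j => [|j IH]; first by rewrite !expr0 mul1r subrr.
  have := MD (MM (a * b) IH) Mab; congr M; rewrite !exprS; ring.
have qbn j : q (b ^+ j) <= Q * q b ^+ j.
  elim: j => [|j IH]; first by rewrite !expr0 mulr1.
  rewrite !exprSr mulrA; apply: le_trans (idistM idealM _ _) _.
  by rewrite ler_wpM2r.
have : Q <= s ^- n.+1 * (q (s%:C ^+ n.+1 *: a ^+ n.+1)%C * q (b ^+ n.+1)).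
  rewrite /Q -(idist_congr idealM (Mabn n.+1)).
  have -> : a ^+ n.+1 * b ^+ n.+1 =
      ((s^-1)%:C ^+ n.+1 *: ((s%:C ^+ n.+1 *: a ^+ n.+1) * b ^+ n.+1))%C.
    have sV : (s^-1)%:C%C ^+ n.+1 * s%:C%C ^+ n.+1 = 1.
      by rewrite -exprMn -rmorphM/= mulVf ?gt_eqF// expr1n.
    by rewrite -banachZAl scalerA sV scale1r.
  apply: le_trans (idistZ idealM _ _) _.
  have sV0 : 0 <= s^-1 by rewrite invr_ge0 ltW.
  by rewrite rnormX rnorm_real// -exprVn ler_wpM2l ?exprn_ge0// idistM.
have sb : s ^- n.+1 * q (b ^+ n.+1) <= Q.
  rewrite mulrC ler_pdivrMr ?exprn_gt0//; apply: le_trans (qbn _) _.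
  rewrite ler_wpM2l// lerXn2r ?nnegrE// ?(ltW s0)//.
  by apply: le_trans kt; rewrite /t; lra.
rewrite mulrCA => h; have : Q <= (4 * (Q + 1))^-1 * Q.
  by apply: le_trans h _; apply: ler_pM => //;
    rewrite ?mulr_ge0 ?invr_ge0 ?exprn_ge0// ltW.
have : 2^-1 <= Q by exact: idist1_ge.
have e1 : (4 * (Q + 1))^-1 <= 4^-1 by rewrite lef_pV2 ?posrE; lra.
by nra.
Qed.

End gelfand_mazur.

(** * The maximal ideal space *)

Lemma complex_continuous_cst (R : realType) (T : topologicalType) (z : R[i]) :
  continuous (fun _ : T => z : R[i]^o).
Proof. by move=> t; exact: cvg_cst. Qed.

Section complex_valued_continuity.
Variables (R : realType) (T : topologicalType) (f g : T -> R[i]^o).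
Hypotheses (fc : continuous f) (gc : continuous g).

Lemma complex_continuousM : continuous (fun t => (f t * g t : R[i]^o)).
Proof.
by move=> t; exact: (@cvgM R[i] _ _ _ f g _ _ (fc (x := t)) (gc (x := t))).
Qed.

Lemma complex_continuousZD z : continuous (fun t => (z *: f t + g t : R[i]^o)).
Proof. 
move=> t; have fz := @cvgZl_tmp R[i] R[i]^o _ _ _ z _ _ (fc (x := t)).
by apply: cvgD; [exact: fz|exact: gc].
 Qed.

Lemma complex_closure_eq (S : set T) (t : T) :
  (forall s, S s -> f s = g s) -> closure S t -> f t = g t.
Proof.
move=> fg St; apply/eqP; rewrite -subr_eq0; apply/eqP/rnorm_eq0/eqP.
rewrite eq_le rnorm_ge0 andbT leNgt; apply/negP => d0.
have d20 : 0 < rnorm (f t - g t) / 2 by rewrite divr_gt0.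
have [s [/fg e [/= fs gs]]] := St _ (filterI
  ((rcvgP _ _ _).1 (fc (x := t)) _ d20) ((rcvgP _ _ _).1 (gc (x := t)) _ d20)).
have := ler_rdistD (f s) (f t) (g t).
move: fs gs; rewrite [rnorm (g t - _)]rdistC e; lra.
Qed.

End complex_valued_continuity.

Section spectrum.
Variables (R : realType) (A : comBanachAlgType R[i]).
Implicit Types (a b : A) (phi : maxspec A).

(** Modulo a maximal ideal every a is congruent to a scalar: otherwise all a - z would be invertible
    modulo it. That scalar is the value of the character. *)
Lemma proper_ideal_character (I : set A) : is_ideal I -> ~ I 1 ->
  exists phi, forall a, I a -> gelfand a phi = 0.
Proof.
move=> II nI1; have [M [IM idM nM1 maxM]] := maximal_ideal_exists II nI1.
have [_ MD MM] := idM.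
have /choice[f fM] : forall a, exists z : R[i], M (a - z *: (1 : A)).
  move=> a; apply: contrapT => na.
  apply: (@gelfand_mazur_contradiction _ _ _ idM nM1 a) => z.
  by apply: maxM => Maz; apply: na; exists z.
have inj1 z : M (z *: (1 : A)) -> z = 0.
  move=> Mz; apply/eqP/negPn/negP => z0; apply: nM1.
  by have := idealZ z^-1 idM Mz; rewrite scalerA mulVf// scale1r.
have fE a z : M (a - z *: (1 : A)) -> f a = z.
  move=> Maz; apply/eqP; rewrite -subr_eq0; apply/eqP/inj1.
  have := idealB idM Maz (fM a); congr M.
  by rewrite scalerBl opprB [a - _]addrC addrACA subrr addr0 addrC.
have fchar : is_character (f : A -> R[i]^o).
  split=> [z a b|a b|].
  - apply: fE; have := MD _ _ (idealZ z idM (fM a)) (fM b); congr M.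
    by rewrite scalerDl scalerBr scalerA opprD addrACA.
  - apply: fE; have := MD _ _ (MM _ b (fM a)) (idealZ (f a) idM (fM b)).
    congr M.
    by rewrite scalerBr scalerA mulrBl -banachZAl mul1r addrA subrK.
  - by exists 1; rewrite (fE _ 1) ?oner_neq0// scale1r subrr; case: idM.
exists (exist _ (f : {ptws A -> R[i]^o}) (mem_set fchar)) => a Ia.
by apply: fE; rewrite scale0r subr0; exact: IM.
Qed.

Let char phi : is_character (set_val phi : A -> R[i]^o).
Proof. exact: set_valP phi. Qed.

Lemma gelfand_linear phi : linear ((fun a => gelfand a phi) : A -> R[i]^o).
Proof. by have [] := char phi. Qed.

Lemma gelfandM phi a b : gelfand (a * b) phi = gelfand a phi * gelfand b phi.
Proof. by have [_ + _] := char phi; apply. Qed.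

Lemma gelfand1 phi : gelfand 1 phi = 1.
Proof.
have [_ _ [a /mulIf]] := char phi; apply.
by rewrite mul1r -[LHS]gelfandM mul1r.
Qed.

Lemma gelfandD phi a b : gelfand (a + b) phi = gelfand a phi + gelfand b phi.
Proof. by have := gelfand_linear phi 1 a b; rewrite !scale1r. Qed.

Lemma gelfand0 phi : gelfand 0 phi = 0.
Proof. by apply: (addIr (gelfand 0 phi)); rewrite -gelfandD !add0r. Qed.

Lemma gelfandZ phi z a : gelfand (z *: a) phi = z * gelfand a phi.
Proof. by have := gelfand_linear phi z a 0; rewrite gelfand0 !addr0. Qed.

Lemma gelfandB phi a b : gelfand (a - b) phi = gelfand a phi - gelfand b phi.
Proof. by rewrite -scaleN1r gelfandD gelfandZ mulN1r. Qed.

(** Beyond this bound, 1 - a / phi(a) would be invertible although phi sends it to 0. The factor 2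
    is the inverse of the radius in [neumann_half]. *)
Lemma rnorm_gelfand phi a : rnorm (gelfand a phi) <= 2 * rnorm a.
Proof.
rewrite leNgt; apply/negP; set z := gelfand a phi => az.
have z0 : 0 < rnorm z by apply: le_lt_trans az; rewrite mulr_ge0 ?rnorm_ge0.
have zn0 : z != 0 by apply/eqP => zE; move: z0; rewrite zE rnorm0 ltxx.
have [|b xb] := @neumann_half _ _ (1 - z^-1 *: a).
  rewrite subKr rnormZ.
  have -> : rnorm z^-1 = (rnorm z)^-1.
    by apply: complexI; rewrite fmorphV/= -!rnormE normfV.
  by rewrite mulrC ler_pdivrMr//; lra.
have /eqP := gelfand1 phi; rewrite -xb gelfandM gelfandB gelfandZ gelfand1.
by rewrite mulVf// subrr mul0r eq_sym oner_eq0.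
Qed.

Lemma gelfand_continuous a : continuous (gelfand a : maxspec A -> R[i]^o).
Proof.
move=> phi; apply: (@continuous_comp _ _ _
  (set_val : maxspec A -> {ptws A -> R[i]^o})
  (fun f => f a)).
  exact: initial_continuous.
exact: proj_continuous.
Qed.

Let characters_closed : closed [set f : {ptws A -> R[i]^o} | is_character f].
Proof.
have ev a : continuous (fun f : {ptws A -> R[i]^o} => f a).
  exact: proj_continuous.
move=> f Sf; split=> [z a b|a b|].
- apply: (complex_closure_eq (ev _)
    (complex_continuousZD (z := z) (ev a) (ev b)) _ Sf).
  by move=> g [gl _ _]; exact: gl.
- apply: (complex_closure_eq (ev _) (complex_continuousM (ev a) (ev b)) _ Sf).
  by move=> g [_ gM _]; exact: gM.
(* Being nonzero is not a closed condition; taking the value 1 at 1 is. *)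
- exists 1; apply/eqP => f1.
  have /eqP : f 1 = 1.
    apply: (complex_closure_eq (ev 1) (@complex_continuous_cst R _ 1) _ Sf).
    by move=> g gchar; exact: (gelfand1 (exist _ g (mem_set gchar))).
  by rewrite f1 eq_sym oner_eq0.
Qed.

(** Banach-Alaoglu: the characters are closed in a product of discs, compact by Tychonoff. Filters
    on the subtype are then pushed to the ambient space. *)
Lemma maxspec_compact : compact [set: maxspec A].
Proof.
pose S := [set f : {ptws A -> R[i]^o} | is_character f].
have cS : compact S.
  have cB : compact
      [set f : {ptws A -> R[i]^o} | forall a, rnorm (f a) <= 2 * rnorm a].
    exact: (@tychonoff A (fun=> R[i]^o)
      (fun a => [set z | rnorm z <= 2 * rnorm a])
      (fun a => @complex_disc_compact R _)).
  apply: (subclosed_compact characters_closed cB).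
  move=> g gchar a; exact: (rnorm_gelfand (exist _ g (mem_set gchar)) a).
move=> F FF _; pose G : set_system {ptws A -> R[i]^o} := set_val @ F.
have PG : ProperFilter G by exact: fmap_proper_filter.
have GS : G S by apply: (@filterS _ F _ setT) filterT => phi _; exact: char phi.
have [f [Sf Gf]] := cS G PG GS.
exists (exist _ f (mem_set Sf)); split=> // U V FU [_ [[W oW <-] Wf WV]].
have GU : G (set_val @` U).
  by apply: (@filterS _ F _ U) FU => phi Uphi; exists phi.
have [_ [[phi Uphi <-] Wphi]] := Gf _ W GU (open_nbhs_nbhs (conj oW Wf)).
by exists phi; split=> //; exact: WV.
Qed.

Lemma gelfand_inj phi psi :
  (forall a, gelfand a phi = gelfand a psi) -> phi = psi.
Proof. by move=> e; apply: val_inj; apply/funext. Qed.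

End spectrum.

Lemma separated_hausdorff (R : realType) (T : topologicalType) (I : Type)
    (h : I -> T -> R[i]^o) :
    (forall i, continuous (h i)) ->
    (forall s t, (forall i, h i s = h i t) -> s = t) ->
  hausdorff_space T.
Proof.
move=> hc hinj s t st; apply: hinj => i; apply: norm_hausdorff => U V Us Vt.
by have [x []] := st _ _ (hc i s _ Us) (hc i t _ Vt); exists (h i x).
Qed.

Lemma maxspec_hausdorff (R : realType) (A : comBanachAlgType R[i]) :
  hausdorff_space (maxspec A).
Proof.
apply: separated_hausdorff (@gelfand_continuous R A) _ => *.
exact: gelfand_inj.
Qed.

(** * Ditkin algebras and C(X, E) *)

(* An algebra of functions on a compact space K that plays the role of M(A).
   Property [rep_ditkin] is weaker than Ditkin's condition, but suffices, and
   with [rep_ideal] it spares the identification of M(C(X, E)) with X * M(E). *)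
Record ditkin_representation (R : realType) (A : comBanachAlgType R[i])
    (K : topologicalType) (ev : K -> A -> R[i]) : Prop := {
  rep_compact : compact [set: K];
  rep_hausdorff : hausdorff_space K;
  rep_linear : forall k z a b, ev k (z *: a + b) = z * ev k a + ev k b;
  rep_mul : forall k a b, ev k (a * b) = ev k a * ev k b;
  rep_one : forall k, ev k 1 = 1;
  rep_continuous : forall a, continuous (fun k => ev k a : R[i]^o);
  rep_bounded : forall k a, rnorm (ev k a) <= 2 * rnorm a;
  rep_faithful : forall a, (forall k, ev k a = 0) -> a = 0;
  rep_regular : forall k U, nbhs k U ->
    exists a, ev k a <> 0 /\ forall l, ~ U l -> ev l a = 0;
  rep_ideal : forall I, is_ideal I ->
    (forall k, exists2 a, I a & ev k a <> 0) -> I 1;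
  rep_ditkin : forall k a (e : R), ev k a = 0 -> 0 < e ->
    exists2 b, (\forall l \near k, ev l b = 0) & rnorm (a - b) < e
}.

Section ditkin_regular.
Variables (R : realType) (E : comBanachAlgType R[i]).
Hypothesis ditkinE : ditkin E.

Lemma ditkin_approx (phi : maxspec E) a (e : R) : gelfand a phi = 0 -> 0 < e ->
  exists2 b, (\forall psi \near phi, gelfand b psi = 0) & rnorm (a - a * b) < e.
Proof.
move=> a0 e0; have := ditkinE a0.
have ae : nbhs a [set c | rnorm (a - c) < e] by apply/rnbhsP; exists e.
move=> /(_ _ ae)[_ [[b bJ <-] abe]]; exists b => //.
apply: contrapT => nb; apply: bJ => U phiU; apply: contrapT => nU; apply: nb.
apply: filterS phiU => psi Upsi; apply: contrapT => /eqP bpsi.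
by apply: nU; exists psi.
Qed.

(** Take a zero at psi but not at phi and approximate it by a b with b zero near psi. If b were zero
    at phi, a - a b would be too small in norm for its value phi(a). *)
Lemma ditkin_separates (phi psi : maxspec E) : phi <> psi ->
  exists2 b, gelfand b phi <> 0 & \forall xi \near psi, gelfand b xi = 0.
Proof.
move=> phipsi; have [c cE] : exists c, gelfand c phi <> gelfand c psi.
  apply: contrapT => nc; apply: phipsi; apply: gelfand_inj => a.
  by apply: contrapT => na; apply: nc; exists a.
pose a := c - gelfand c psi *: (1 : E).
have apsi : gelfand a psi = 0 by rewrite gelfandB gelfandZ gelfand1 mulr1 subrr.
have aphi : gelfand a phi <> 0.
  by rewrite gelfandB gelfandZ gelfand1 mulr1 => /subr0_eq.
have d0 : 0 < rnorm (gelfand a phi) / 4.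
  by rewrite divr_gt0// lt_def rnorm_ge0 andbT; apply/eqP => /rnorm_eq0.
have [b b0 ab] := ditkin_approx apsi d0; exists b => // bphi.
have := rnorm_gelfand phi (a - a * b).
by rewrite gelfandB gelfandM bphi mulr0 subr0; lra.
Qed.

(** Finitely many separating elements handle the compact complement of the interior of [U]; their
    product is nonzero at phi because phi is multiplicative. *)
Lemma ditkin_regular (phi : maxspec E) (U : set (maxspec E)) : nbhs phi U ->
  exists a, gelfand a phi <> 0 /\ forall psi, ~ U psi -> gelfand a psi = 0.
Proof.
move=> phiU; have cU : compact (~` U°).
  apply: (subclosed_compact (open_closedC (@open_interior _ U))
    (@maxspec_compact R E)).
  by [].
have [|S S' SS' [b [b0 bS']]|S S' [b [b0 bS]] [c [c0 cS']]|psi nUpsi|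
    a [a0 aU]] :=
  @compact_induction _ _ (fun S => exists a, gelfand a phi <> 0 /\
    forall psi, S psi -> gelfand a psi = 0) cU.
- by exists 1; split=> //; rewrite gelfand1; exact/eqP/oner_neq0.
- by exists b; split=> // psi /SS'/bS'.
- exists (b * c); split=> [|psi [Spsi|Spsi]]; rewrite gelfandM.
  + by move/eqP; rewrite mulf_eq0 => /orP[]/eqP.
  + by rewrite bS// mul0r.
  + by rewrite cS'// mulr0.
- have [|b b0 bpsi] := @ditkin_separates phi psi.
    by move=> e; apply: nUpsi; rewrite -e.
  by exists [set xi | gelfand b xi = 0] => //; exists b.
exists a; split=> // psi nU; apply: aU => /= Upsi.
by apply: nU; exact: interior_subset.
Qed.

End ditkin_regular.

(** * Cutoff functions on a compact Hausdorff space *)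

Section cutoff.
Variables (R : realType) (X : compactHausdorffType).

(** Urysohn's lemma is applied to a closed neighbourhood of x rather than to x, so that u is 1 near
    x. *)
Lemma cutoff_exists (x : X) (U : set X) : nbhs x U ->
  exists u : X -> R, [/\ continuous u, forall y, 0 <= u y <= 1,
    \forall y \near x, u y = 1 & forall y, ~ U y -> u y = 0].
Proof.
move=> xU; have hX := @hausdorff_setT X; have cX := @compact_setT X.
have [V xV VU] : filter_from (nbhs x) closure U°.
  apply: (@compact_regular _ x setT hX cX); first exact: filterT.
  exact: nbhs_interior.
have [|u [uc u01 u0 u1]] := (@uniform_separatorP X R (~` U°) (closure V)).1.
  apply: normal_uniform_separator.
  - exact: compact_normal.
  - exact: open_closedC (@open_interior _ U).
  - exact: closed_closure.
  - by rewrite -subset0 => y [/= nU /VU].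
exists u; split=> //.
- by move=> y; have := u01 (u y) (ex_intro2 _ _ y I erefl); rewrite /= in_itv.
- apply: filterS xV => y Vy; apply: u1; exists y => //.
  exact: subset_closure.
- move=> y nUy; apply: u0; exists y => // /interior_subset.
  exact: nUy.
Qed.

Variable E : comBanachAlgType R[i].

Lemma scaled_continuous (u : X -> R) (f : contfun X E) : continuous u ->
  continuous (fun y => (u y)%:C%C *: f y).
Proof.
move=> uc x; apply: cvgZ; last exact: (@contfun_continuous R X E f x).
apply/(@rcvgP R R[i]^o) => e e0.
have /cvgrPdist_lt/(_ e e0) := uc x; apply: filterS => y.
suff -> : rnorm ((u x)%:C%C - (u y)%:C%C : R[i]) = `|u x - u y| by [].
by rewrite -rmorphB/= /rnorm normc_def/= expr0n addr0 sqrtr_sqr.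
Qed.

Lemma const_continuous (a : E) : continuous (fun _ : X => a).
Proof. by move=> x; exact: cvg_cst. Qed.

Lemma rnorm_contfun_le (f : contfun X E) (M : R) : 0 <= M ->
  (forall y, rnorm (f y) <= M) -> rnorm f <= M.
Proof.
move=> M0 fM; rewrite /rnorm contfun_normE/=; apply: contfun_norm_le => // y.
by rewrite rnormE lecR.
Qed.

Lemma rnorm_contfun_ge (f : contfun X E) y : rnorm (f y) <= rnorm f.
Proof.
rewrite -lecR -!rnormE contfun_normE; exact: contfun_norm_ub.
Qed.

End cutoff.

(** * C(X, E) as an algebra of functions on X * M(E) *)

Section contfun_representation.
Variables (R : realType) (X : compactHausdorffType) (E : comBanachAlgType R[i]).
Hypotheses (semisimpleE : semisimple E) (ditkinE : ditkin E).
Local Notation K := (X * maxspec E)%type.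
Implicit Types (f g : contfun X E) (k : K).

Definition contfun_eval k f : R[i] := gelfand (f k.1) k.2.

Let cst (a : E) : contfun X E := mkcontfun (@const_continuous R X E a).
Let scaled (u : X -> R) (uc : continuous u) f : contfun X E :=
  mkcontfun (@scaled_continuous R X E u f uc).

Let eval_continuous f : continuous (fun k => contfun_eval k f : R[i]^o).
Proof.
move=> [x phi]; apply/rcvgP => e e0; rewrite /contfun_eval/=.
have e4 : 0 < e / 4 by rewrite divr_gt0.
have e2 : 0 < e / 2 by rewrite divr_gt0.
exists ([set y | rnorm (f x - f y) < e / 4],
        [set psi | rnorm (gelfand (f x) phi - gelfand (f x) psi) < e / 2]).
  split; first exact: (rcvgP _ _ _).1 (@contfun_continuous R X E f x) _ e4.
  exact: (rcvgP _ _ _).1 (@gelfand_continuous R E (f x) phi) _ e2.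
move=> [y psi] [/= fxy fpsi].
have := ler_rdistD (gelfand (f x) psi) (gelfand (f x) phi) (gelfand (f y) psi).
have := rnorm_gelfand psi (f x - f y); rewrite gelfandB; lra.
Qed.

Let eval_regular k U : nbhs k U ->
  exists f, contfun_eval k f <> 0 /\ forall l, ~ U l -> contfun_eval l f = 0.
Proof.
case: k => x phi [[V W] [/= xV phiW] VWU].
have [u [uc _ u1 u0]] := @cutoff_exists R X x V xV.
have [b [b0 bW]] := ditkin_regular ditkinE phiW.
exists (scaled uc (cst b)).
rewrite /contfun_eval/=; split=> [|[y psi] nU /=]; rewrite gelfandZ.
  by rewrite (nbhs_singleton u1) mul1r.
have [Vy|nVy] := pselect (V y); last by rewrite u0// mul0r.
by rewrite bW ?mulr0// => Wpsi; apply: nU; exact: VWU.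
Qed.

(** The values at x of an ideal form an ideal of E; if it were proper, a character phi would kill
    it, against the hypothesis at (x, phi). *)
Let ideal_unit_at (I : set (contfun X E)) (x : X) : is_ideal I ->
    (forall k, exists2 f, I f & contfun_eval k f <> 0) ->
  exists2 f, I f & f x = 1.
Proof.
move=> [I0 ID IM] Ik; pose J := [set f x | f in I].
have JI : is_ideal J.
  split; first by exists 0.
  - by move=> _ _ [f If <-] [g Ig <-]; exists (f + g) => //; exact: ID.
  - move=> _ b [f If <-]; exists (f * cst b) => //.
    exact: IM.
have [[f If fx]|nJ] := pselect (J 1); first by exists f.
have [phi phiJ] := proper_ideal_character JI nJ.
by have [f If []] := Ik (x, phi); apply: phiJ; exists f.
Qed.

Let eval_ideal (I : set (contfun X E)) : is_ideal I ->
  (forall k, exists2 f, I f & contfun_eval k f <> 0) -> I 1.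
Proof.
move=> II Ik; have [I0 ID IM] := II.
suff [f If f1] : exists2 f, I f & forall x, setT x -> f x = 1.
  by rewrite (_ : 1 = f)//; apply: contfunP => x; rewrite f1.
have := @compact_induction _ _
  (fun S => exists2 f, I f & forall x, S x -> f x = 1) (@compact_setT X).
apply.
- by exists 0.
- by move=> S S' SS' [f If fS]; exists f => // x /SS'/fS.
(* 1 - (1 - f) (1 - g) is 1 wherever f or g is. *)
- move=> S S' [f If fS] [g Ig gS]; exists (f + g - f * g).
    by apply: idealB => //; [exact: ID|exact: IM].
  move=> x [Sx|S'x].
    rewrite -[LHS]/(f x + g x - f x * g x) fS// mul1r addrK//.
  by rewrite -[LHS]/(f x + g x - f x * g x) gS// mulr1 addrAC subrr add0r.
move=> x _; have [f If fx] := ideal_unit_at x II Ik.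
have fW : \forall y \near x, rnorm (f x - f y) < 2^-1.
  by apply: ((rcvgP _ _ _).1 (@contfun_continuous R X E f x)); rewrite invr_gt0.
have [u [uc u01 u1 u0]] := @cutoff_exists R X x _ fW.
(* The cutoff keeps g within 1/2 of 1 on all of X, hence invertible, while g = f near x; so f times
   the inverse of g is 1 near x. *)
pose g : contfun X E := 1 - scaled uc (1 - f).
have [|h gh] := @neumann_half _ _ g.
  apply: rnorm_contfun_le => [|y]; first by rewrite invr_ge0.
  rewrite -[X in rnorm X]/(1 - (1 - (u y)%:C%C *: (1 - f y))) subKr rnormZ.
  have /andP[uy0 uy1] := u01 y; rewrite rnorm_real//.
  have [Wy|nWy] := pselect (rnorm (f x - f y) < 2^-1).
    rewrite -fx; apply: le_trans (ltW Wy).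
    by rewrite ler_piMl ?rnorm_ge0.
  by rewrite u0// mul0r invr_ge0.
exists [set y | u y = 1] => //; exists (f * h); first exact: IM.
move=> y uy; have <- : (g * h) y = 1 by rewrite gh.
rewrite -[LHS]/(f y * h y) -[RHS]/((1 - (u y)%:C%C *: (1 - f y)) * h y) uy.
by rewrite scale1r subKr.
Qed.

Let eval_ditkin k f (e : R) : contfun_eval k f = 0 -> 0 < e ->
  exists2 g, (\forall l \near k, contfun_eval l g = 0) & rnorm (f - g) < e.
Proof.
case: k => x phi; rewrite /contfun_eval/= => fx0 e0.
have e4 : 0 < e / 4 by rewrite divr_gt0.
have [b b0 fb] := ditkin_approx ditkinE fx0 e4.
have fW : \forall y \near x, rnorm (f x - f y) < e / 4.
  exact: (rcvgP _ _ _).1 (@contfun_continuous R X E f x) _ e4.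
have [u [uc u01 u1 u0]] := @cutoff_exists R X x _ fW.
(* Near x the corrected function is the constant f(x) b, which vanishes near phi; the cutoff
   confines the correction to where [h] has norm at most e / 2. *)
pose h : contfun X E := f - cst (f x * b).
pose g : contfun X E := f - scaled uc (h).
exists g.
  exists ([set y | u y = 1], [set psi | gelfand b psi = 0]) => //.
  move=> [y psi] [/= uy bpsi].
  have gy : g y = f x * b.
    by rewrite -[LHS]/(f y - (u y)%:C%C *: (f y - f x * b)) uy scale1r subKr.
  by rewrite -[LHS]/(gelfand (g y) psi) gy gelfandM bpsi mulr0.
apply: (@le_lt_trans _ _ (e / 2)); last by lra.
apply: rnorm_contfun_le => [|y]; first by rewrite divr_ge0// ltW.
rewrite -[X in rnorm X]/(f y - (f y - (u y)%:C%C *: (f y - f x * b))) subKr.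
have /andP[uy0 uy1] := u01 y; rewrite rnormZ rnorm_real//.
have [Wy|nWy] := pselect (rnorm (f x - f y) < e / 4).
  apply: (@le_trans _ _ (rnorm (f y - f x * b))).
    by rewrite ler_piMl ?rnorm_ge0.
  have := ler_rdistD (f x) (f y) (f x * b); rewrite [rnorm (f y - f x)]rdistC.
  lra.
by rewrite u0// mul0r divr_ge0// ltW.
Qed.

Lemma contfun_eval_representation : ditkin_representation contfun_eval.
Proof.
split.
- rewrite -setXTT; apply: compact_setX; first exact: compact_setT.
  exact: maxspec_compact.
- move=> [x phi] [y psi] st.
  have xy : x = y.
    apply: (@hausdorff_setT X) => U V Ux Vy.
    have [||[z xi] [Uz Vz]] := st (fst @^-1` U) (fst @^-1` V).
    + exact: cvg_fst.
    + exact: cvg_fst.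
    by exists z.
  rewrite xy; congr pair; apply: (@maxspec_hausdorff R E) => U V Ux Vy.
  have [||[z xi] [Uz Vz]] := st (snd @^-1` U) (snd @^-1` V).
  + exact: cvg_snd.
  + exact: cvg_snd.
  by exists xi.
- move=> k z f g; rewrite /contfun_eval.
  by rewrite -[X in gelfand X _]/(z *: f k.1 + g k.1) gelfandD gelfandZ.
- by move=> k f g; rewrite /contfun_eval -gelfandM.
- by move=> k; exact: gelfand1.
- exact: eval_continuous.
- move=> k f; apply: le_trans (rnorm_gelfand _ _) _.
  by rewrite ler_wpM2l// rnorm_contfun_ge.
- move=> f f0; apply: contfunP => x; apply: semisimpleE; apply/funext => phi.
  by rewrite [RHS]gelfand0; exact: (f0 (x, phi)).
- exact: eval_regular.
- exact: eval_ideal.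
- exact: eval_ditkin.
Qed.

End contfun_representation.

(** * Separating bijections *)

Lemma closed_neighbourhood (T : topologicalType) (x : T) (U : set T) :
  compact [set: T] -> hausdorff_space T -> nbhs x U ->
  exists2 V, nbhs x V & closure V `<=` U.
Proof.
move=> cT hT xU.
by have := @compact_regular _ x setT hT cT filterT U xU; case=> V; exists V.
Qed.

(** Of two points of an infinite set with neighbourhoods of disjoint closures, at least one has a
    neighbourhood whose closure misses infinitely many points of the set. Iterate on what is
    left. *)
Lemma infinite_disjoint_nbhs (T : topologicalType) (S : set T) :
  compact [set: T] -> hausdorff_space T -> infinite_set S ->
  exists (x : nat -> T) (U : nat -> set T), [/\ forall n, S (x n),
    forall n, nbhs (x n) (U n) & forall m n z, U m z -> U n z -> m = n].
Proof.
move=> cT hT infS.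
have step (Q : set T) : exists p : T * set T, infinite_set Q ->
    [/\ Q p.1, nbhs p.1 p.2 & infinite_set (Q `\` closure p.2)].
  have [infQ|nQ] := pselect (infinite_set Q); last first.
    have [x _] := infinite_setN0 infS.
    by exists (x, set0) => infQ.
  have [x Qx] := infinite_setN0 infQ.
  have [y [Qy /= /eqP yx]] : (Q `\ x) !=set0.
    by apply/infinite_setN0/infinite_setD => //; exact: finite_set1.
  have := hT; rewrite open_hausdorff => /(_ _ _ yx)[[U V]/=].
  move=> [/set_mem Uy /set_mem Vx] [oU oV /eqP UV].
  have [U' yU' U'U] := closed_neighbourhood cT hT (open_nbhs_nbhs (conj oU Uy)).
  have [V' xV' V'V] := closed_neighbourhood cT hT (open_nbhs_nbhs (conj oV Vx)).
  have [infU|finU] := pselect (infinite_set (Q `\` closure U')).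
    by exists (y, U').
  exists (x, V') => _; split=> //= finV; apply: infQ.
  apply: (@sub_finite_set _ _ ((Q `\` closure U') `|` (Q `\` closure V'))).
    move=> z Qz; have [/U'U Uz|nUz] := pselect (closure U' z); last by left.
    right; split=> // /V'V Vz.
    by have : (U `&` V) z by []; rewrite UV.
  by rewrite finite_setU; split=> //; exact: contrapT.
have [p pP] := choice step.
pose Q := fix Q n := if n is m.+1 then Q m `\` closure (p (Q m)).2 else S.
have infQ n : infinite_set (Q n).
  by elim: n => [|n IH] //=; have [] := pP _ IH.
have subQ m n : (m <= n)%N -> Q n `<=` Q m.
  move=> /subnKC <-; elim: (n - m)%N => [|j IH]; first by rewrite addn0.
  by rewrite addnS => z /= [/IH].
have Qcl m n : (m < n)%N -> forall z, Q n z -> ~ closure (p (Q m)).2 z.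
  by move=> mn z /(subQ _ _ mn)[].
(* Removing the earlier closures makes the neighbourhoods disjoint. *)
exists (fun n => (p (Q n)).1), (fun n => (p (Q n)).2 `&`
  [set z | forall m, (m < n)%N -> ~ closure (p (Q m)).2 z]); split.
- by move=> n; have [+ _ _] := pP _ (infQ n); exact: (subQ 0%N).
- move=> n; have [Qn pn _] := pP _ (infQ n); apply: filterI => //.
  suff h j : (j <= n)%N -> nbhs (p (Q n)).1
      [set z | forall m, (m < j)%N -> ~ closure (p (Q m)).2 z] by exact: h.
  elim: j => [|j IH] jn; first exact: filterE.
  have : nbhs (p (Q n)).1 (~` closure (p (Q j)).2).
    apply: open_nbhs_nbhs; split; last exact: Qcl jn _ Qn.
    exact/closed_openC/closed_closure.
  move=> nj; apply: filterS (filterI nj (IH (ltnW jn))) => z [zj zm] m.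
  by rewrite ltnS leq_eqVlt => /orP[/eqP ->|/zm].
- move=> m n z [Umz ncm] [Unz ncn].
  case: (ltngtP m n) => // [/ncn|/ncm] [];
    exact: subset_closure.
Qed.

(** * Localisation in a represented algebra *)

Section representation_theory.
Variables (R : realType) (A : comBanachAlgType R[i]) (K : topologicalType).
Variable ev : K -> A -> R[i].
Hypothesis rep : ditkin_representation ev.
Implicit Types (a b : A) (k l : K).

Lemma rep_add k a b : ev k (a + b) = ev k a + ev k b.
Proof. by rewrite -[a]scale1r (rep_linear rep) mul1r scale1r. Qed.

Lemma rep0 k : ev k 0 = 0.
Proof. by apply: (addIr (ev k 0)); rewrite -rep_add !add0r. Qed.

Lemma rep_scale k z a : ev k (z *: a) = z * ev k a.
Proof. by rewrite -[z *: a]addr0 (rep_linear rep) rep0 addr0. Qed.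

Lemma rep_sub k a b : ev k (a - b) = ev k a - ev k b.
Proof. by rewrite -scaleN1r rep_add rep_scale mulN1r. Qed.

Lemma rep_ext a b : (forall k, ev k a = ev k b) -> a = b.
Proof.
move=> ab; apply/eqP; rewrite -subr_eq0; apply/eqP/(rep_faithful rep) => k.
by rewrite rep_sub ab subrr.
Qed.

Lemma rep_mul_eq0 a b : (forall k, ev k a = 0 \/ ev k b = 0) -> a * b = 0.
Proof.
move=> ab; apply/(rep_faithful rep) => k; rewrite (rep_mul rep).
by case: (ab k) => ->; rewrite ?mul0r ?mulr0.
Qed.

Lemma rep_neq0_near k a : ev k a <> 0 -> \forall l \near k, ev l a <> 0.
Proof.
move=> ka; have k0 : 0 < rnorm (ev k a).
  by rewrite lt_def rnorm_ge0 andbT; apply/eqP => /rnorm_eq0.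
apply: filterS ((rcvgP _ _ _).1 (@rep_continuous _ _ _ _ rep a k) _ k0) => l.
by move=> + l0; rewrite l0 subr0 ltxx.
Qed.

(** Support points only detect vanishing near a point, so a closed neighbourhood inside [U] is
    interposed. *)
Lemma rep_bump k U : nbhs k U ->
  exists a, ev k a <> 0 /\
    forall l, closure (~` U) l -> \forall j \near l, ev j a = 0.
Proof.
move=> kU; have [V kV VU] := closed_neighbourhood (rep_compact rep)
  (rep_hausdorff rep) (nbhs_interior kU).
have [a [ka aV]] := rep_regular rep kV; exists a; split=> // l Ul.
suff lV : nbhs l (~` closure V).
  by apply: filterS lV => j Vj; apply: aV => /subset_closure.
apply: open_nbhs_nbhs; split; first exact/closed_openC/closed_closure.
by move=> /VU; rewrite -[U]setCK interiorC.
Qed.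

(** Sums of an element supported in [U] and one vanishing near k form an ideal that lies in no
    kernel: at k use the first kind, elsewhere the second. Its decomposition of 1 gives the unit. *)
Lemma rep_local_unit k U : nbhs k U ->
  exists a, (\forall l \near k, ev l a = 1) /\ forall l, ~ U l -> ev l a = 0.
Proof.
move=> kU; pose I := [set c | exists a b, [/\ c = a + b,
  forall l, ~ U l -> ev l a = 0 & \forall l \near k, ev l b = 0]].
suff [a [b [abE aU bk]]] : I 1.
  exists a; split=> //; apply: filterS bk => l bl.
  by rewrite -(rep_one rep l) abE rep_add bl addr0.
apply: (rep_ideal rep) => [|l].
  split.
  - exists 0, 0; rewrite addr0; split=> //; first by move=> l _; exact: rep0.
    by apply: nearW => l; exact: rep0.
  - move=> _ _ [a [b [-> aU bk]]] [a' [b' [-> aU' bk']]].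
    exists (a + a'), (b + b'); split; first by ring.
      by move=> l nU; rewrite rep_add aU// aU'// addr0.
    by near=> l; rewrite rep_add (near bk)// (near bk')// addr0.
  - move=> _ c [a [b [-> aU bk]]]; exists (a * c), (b * c); split.
    + by ring.
    + by move=> l nU; rewrite (rep_mul rep) aU// mul0r.
    by near=> l; rewrite (rep_mul rep) (near bk)// mul0r.
have [<-|kl] := pselect (k = l).
  have [a [ka aU]] := rep_regular rep kU; exists a => //; exists a, 0.
  by rewrite addr0; split=> //; apply: nearW => j; exact: rep0.
have := rep_hausdorff rep; rewrite open_hausdorff.
move=> /(_ _ _ (introN eqP kl))[[V W]/= [/set_mem Vk /set_mem Wl]].
move=> [oV oW /eqP VW].
have [a [la aW]] := rep_regular rep (open_nbhs_nbhs (conj oW Wl)).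
exists a => //; exists 0, a; rewrite add0r; split=> //.
  by move=> j _; exact: rep0.
apply: filterS (open_nbhs_nbhs (conj oV Vk)) => j Vj; apply: aW => Wj.
by have : (V `&` W) j by []; rewrite VW.
Unshelve. all: by end_near. Qed.

End representation_theory.

(** * The support map and the weighted composition formula *)

Section separating_bijection.
Variables (R : realType) (A B : comBanachAlgType R[i]).
Variables (K L : topologicalType) (ev : K -> A -> R[i]) (ew : L -> B -> R[i]).
Hypotheses (repA : ditkin_representation ev) (repB : ditkin_representation ew).
Variable T : {linear A -> B}.
Hypothesis bijT : bijective T.
Hypothesis sepT : forall f g, f * g = 0 -> T f * T g = 0.
Implicit Types (f g e : A) (k : K) (y : L).

Let K_compact := rep_compact repA.
Let K_hausdorff := rep_hausdorff repA.

Let T_onto u : exists f, T f = u.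
Proof. by have [S _ TS] := bijT; exists (S u). Qed.

Let T_eq0 f : (forall y, ew y (T f) = 0) -> f = 0.
Proof.
move=> Tf0; apply: (bij_inj bijT); rewrite linear0.
exact: (rep_faithful repB).
Qed.

(* The elements e such that T (e f) vanishes at y for all f form an ideal; if y
   had no support point, this ideal would contain 1. *)
Let support_point_exists y : exists k, forall U, nbhs k U ->
  exists f, (forall l, ~ U l -> ev l f = 0) /\ ew y (T f) <> 0.
Proof.
apply: contrapT => nk; pose I := [set e | forall f, ew y (T (e * f)) = 0].
have I1 : I 1.
  apply: (rep_ideal repA) => [|k].
    split.
    - by move=> f; rewrite mul0r linear0 (rep0 repB).
    - move=> a b Ia Ib f.
      by rewrite mulrDl linearD (rep_add repB) Ia Ib addr0.
    - by move=> a b Ia f; rewrite -mulrA Ia.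
  have [U kU nU] : exists2 U, nbhs k U &
      forall f, (forall l, ~ U l -> ev l f = 0) -> ew y (T f) = 0.
    apply: contrapT => nU; apply: nk; exists k => U kU.
    apply: contrapT => nf; apply: nU; exists U => // f fU.
    by apply: contrapT => Tf; apply: nf; exists f.
  have [a [ka aU]] := rep_regular repA kU; exists a => // f; apply: nU => l nUl.
  by rewrite (rep_mul repA) aU// mul0r.
have [f Tf1] := T_onto 1.
have := I1 f; rewrite mul1r Tf1 (rep_one repB) => /eqP.
by rewrite oner_eq0.
Qed.

Let h y := projT1 (cid (support_point_exists y)).
Let hP y U : nbhs (h y) U ->
  exists f, (forall l, ~ U l -> ev l f = 0) /\ ew y (T f) <> 0.
Proof. exact: projT2 (cid (support_point_exists y)) U. Qed.

Let vanish y f : (\forall k \near h y, ev k f = 0) -> ew y (T f) = 0.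
Proof.
move=> /hP[g [gU Tg]]; have /sepT Tfg : f * g = 0.
  apply: (rep_mul_eq0 repA) => k.
  by have [|/gU] := pselect (ev k f = 0); [left|right].
have /eqP := rep0 repB y; rewrite -Tfg (rep_mul repB) mulf_eq0.
by move=> /orP[/eqP|/eqP].
Qed.

Let near_eq y f g : (\forall k \near h y, ev k f = ev k g) ->
  ew y (T f) = ew y (T g).
Proof.
move=> fg; apply/eqP; rewrite -subr_eq0 -(rep_sub repB) -linearB; apply/eqP.
apply: vanish; apply: filterS fg => k; rewrite (rep_sub repA) => ->.
exact: subrr.
Qed.

(** If f is supported in [V] and T f (y) is nonzero, then T f (z) is nonzero for z near y, which
    forces [h z] into the closure of [V]. *)
Let h_continuous : continuous h.
Proof.
move=> y U hyU.
have [V hyV VU] := closed_neighbourhood K_compact K_hausdorff hyU.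
have [f [fV Tf]] := hP hyV.
apply: filterS (rep_neq0_near repB Tf) => z Tfz; apply: VU.
apply: contrapT => nV; apply: Tfz; apply: vanish.
have : nbhs (h z) (~` closure V).
  by apply: open_nbhs_nbhs; split=> //; exact/closed_openC/closed_closure.
by apply: filterS => k Vk; apply: fV => /subset_closure.
Qed.

(** The range is compact, so a point off it carries a nonzero element vanishing near the range,
    whose image would be 0. *)
Let h_onto k : exists y, h y = k.
Proof.
apply: contrapT => nk.
have cr : closed (range h).
  apply: compact_closed K_hausdorff _; apply: continuous_compact.
    exact: continuous_subspaceT h_continuous.
  exact: rep_compact repB.
have kr : nbhs k (~` range h).
  apply: open_nbhs_nbhs; split; first exact: closed_openC.
  by move=> [y _ hy]; apply: nk; exists y.
have [a [ka ar]] := rep_bump repA kr.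
apply: ka; rewrite (@T_eq0 a) ?(rep0 repA)// => y; apply: vanish; apply: ar.
by rewrite setCK; apply: subset_closure; exists y.
Qed.

Let bounded_at y := exists M : R, forall f, rnorm (ew y (T f)) <= M * rnorm f.

(** The kernel of evaluation at [h y] is killed, since its elements are limits of elements vanishing
    near [h y]. Apply this to f minus its value at [h y]. *)
Let weighted_composition y f : bounded_at y ->
  ew y (T f) = ew y (T 1) * ev (h y) f.
Proof.
move=> [M TM].
have ker g : ev (h y) g = 0 -> ew y (T g) = 0.
  move=> g0; apply/rnorm_eq0/eqP; rewrite eq_le rnorm_ge0 andbT.
  apply/ler_addgt0Pr => d d0; rewrite add0r.
  have M0 : 0 < `|M| + 1 by have := normr_ge0 M; lra.
  have [b b0 gb] := rep_ditkin repA g0 (divr_gt0 d0 M0).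
  have -> : ew y (T g) = ew y (T (g - b)).
    apply: near_eq; apply: filterS b0 => k kb.
    by rewrite (rep_sub repA) kb subr0.
  apply: le_trans (TM _) _; apply: (@le_trans _ _ (`|M| * rnorm (g - b))).
    by rewrite ler_wpM2r ?rnorm_ge0// ler_norm.
  apply: (@le_trans _ _ (`|M| * (d / (`|M| + 1)))).
    by rewrite ler_wpM2l// ltW.
  by rewrite mulrCA ler_piMr ?ltW// ltr_pdivrMr// mul1r ltrDl.
have /ker : ev (h y) (f - ev (h y) f *: (1 : A)) = 0.
  by rewrite (rep_sub repA) (rep_scale repA) (rep_one repA) mulr1 subrr.
by rewrite linearB linearZ/= (rep_sub repB) (rep_scale repB) mulrC => /subr0_eq.
Qed.

(** Boundedness at y, with a constant depending on y, improves to one constant for all such y; 4 is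
    the product of the two factors 2 of [rep_bounded]. *)
Let weight_bound y f : bounded_at y ->
  rnorm (ew y (T f)) <= 4 * rnorm (T 1) * rnorm f.
Proof.
move=> /weighted_composition ->; rewrite rnormM.
apply: le_trans (ler_pM (rnorm_ge0 _) (rnorm_ge0 _) (rep_bounded repB _ _)
  (rep_bounded repA _ _)) _.
by have := rnorm_ge0 (T 1); have := rnorm_ge0 f; nra.
Qed.

(* Gliding hump: unboundedness at infinitely many points of [h] could be
   concentrated on disjoint neighbourhoods and summed to one element of [A]. *)
Let unbounded_finite : finite_set (h @` [set y | ~ bounded_at y]).
Proof.
apply: contrapT => /(infinite_disjoint_nbhs K_compact K_hausdorff).
move=> [x [U [xP xU disjU]]].
have /choice[z zP] n : exists y, ~ bounded_at y /\ h y = x n.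
  by have [y ? ?] := xP n; exists y.
have /choice[f fP] n : exists f, [/\ forall k, ~ U n k -> ev k f = 0,
    rnorm f <= 1 / 2 ^+ n & n%:R < rnorm (ew (z n) (T f))].
  have [nb hz] := zP n.
  have [e [e1 eU]] := rep_local_unit repA (xU n); rewrite -hz in e1.
  have e0 : 0 < rnorm e + 1 by have := rnorm_ge0 e; lra.
  (* Chosen so that, after localising f by e and scaling f e to norm at most 2^-n, the value at
     [z n] still exceeds n. *)
  pose M := n%:R * 2 ^+ n * (rnorm e + 1).
  have [f fM] : exists f, M * rnorm f < rnorm (ew (z n) (T f)).
    apply: contrapT => nf; apply: nb; exists M => f; rewrite leNgt.
    by apply/negP => fM; apply: nf; exists f.
  have f0 : 0 < rnorm f.
    rewrite lt_def rnorm_ge0 andbT; apply/eqP => /rnorm_eq0 f0.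
    by move: fM; rewrite f0 linear0 (rep0 repB) !rnorm0 mulr0 ltxx.
  pose c := (2 ^+ n * (rnorm e + 1) * rnorm f)^-1.
  have c0 : 0 < c by rewrite invr_gt0 !mulr_gt0// exprn_gt0.
  have c0' := ltW c0.
  exists (c%:C%C *: (f * e)); split.
  - by move=> k nU; rewrite (rep_scale repA) (rep_mul repA) eU// !mulr0.
  - rewrite rnormZ rnorm_real//.
    apply: (@le_trans _ _ (c * (rnorm f * (rnorm e + 1)))).
      rewrite ler_wpM2l//; apply: le_trans (ler_rnormM _ _) _.
      by rewrite ler_wpM2l ?rnorm_ge0// lerDl.
    rewrite /c le_eqVlt; apply/orP; left; apply/eqP; field.
    by rewrite !gt_eqF ?exprn_gt0.
  rewrite linearZ (rep_scale repB) rnormM rnorm_real//.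
  have -> : ew (z n) (T (f * e)) = ew (z n) (T f).
    apply: near_eq; apply: filterS e1 => k k1.
    by rewrite (rep_mul repA) k1 mulr1.
  rewrite mulrC -ltr_pdivrMr// invrK; apply: le_lt_trans fM.
  by rewrite /M !mulrA.
pose u n := \sum_(j < n) f j.
have [|F uF _] := @cvg_half_steps R A u 1.
  move=> n; have [_ + _] := fP n.
  by rewrite /u big_ord_recr/= addrAC subrr add0r.
(* On [U n] all other summands vanish, so the partial sums are constant there from n + 1 on. *)
have Fn n k : U n k -> ev k F = ev k (f n).
  move=> Unk; have ukn m : (n < m)%N -> ev k (u m) = ev k (f n).
    have ev_sum : ev k (u m) = \sum_(j < m) ev k (f j).
      rewrite /u; elim: m => [|m IH]; first by rewrite !big_ord0 (rep0 repA).
      by rewrite !big_ord_recr/= (rep_add repA) IH.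
    move=> nm; rewrite ev_sum (bigD1 (Ordinal nm))//= big1 ?addr0// => j jn.
    have [+ _ _] := fP j; apply=> Ujk; move/eqP: jn; apply.
    by apply: val_inj; exact: disjU Ujk Unk.
  apply/eqP; rewrite -subr_eq0; apply/eqP/rnorm_eq0/eqP.
  rewrite eq_le rnorm_ge0 andbT; apply/ler_addgt0Pr => d d0; rewrite add0r.
  have d2 : 0 < d / 2 by rewrite divr_gt0.
  have [m _ /(_ (m + n.+1)%N (leq_addr _ _))/= um] := (rcvgP _ _ _).1 uF _ d2.
  rewrite -(ukn (m + n.+1)%N) ?leq_addl// -(rep_sub repA).
  by apply: le_trans (rep_bounded repA _ _) _; lra.
have TF n : n%:R < rnorm (ew (z n) (T F)).
  have [_ _] := fP n; suff -> : ew (z n) (T F) = ew (z n) (T (f n)) by [].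
  by apply: near_eq; have [_ ->] := zP n; apply: filterS (xU n); exact: Fn.
have := TF (Num.truncn (2 * rnorm (T F))).+1; apply/negP; rewrite -leNgt.
by apply: le_trans (rep_bounded repB _ _) _; rewrite ltW// truncnS_gt.
Qed.

(** Bounded points obey the single bound of [weight_bound], and violating it is an open
    condition. *)
Let unbounded_open y : ~ bounded_at y -> \forall z \near y, ~ bounded_at z.
Proof.
move=> ny; pose M := 4 * rnorm (T 1).
have [f fM] : exists f, M * rnorm f < rnorm (ew y (T f)).
  apply: contrapT => nf; apply: ny; exists M => f; rewrite leNgt.
  by apply/negP => fM; apply: nf; exists f.
have d0 : 0 < rnorm (ew y (T f)) - M * rnorm f by rewrite subr_gt0.
apply: filterS ((rcvgP _ _ _).1 (@rep_continuous _ _ _ _ repB (T f) y) _ d0).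
move=> z /= yz /(weight_bound f); rewrite -/M.
have := ler_rnormD (ew y (T f) - ew z (T f)) (ew z (T f)); rewrite subrK; lra.
Qed.

(* Otherwise take T f <> 0 supported on the open set of unbounded points: then
   f vanishes off the finite set Z, so its cozero set contains an isolated point
   of K, and T is bounded at the points lying above it. *)
Let bounded_everywhere y : bounded_at y.
Proof.
apply: contrapT => ny; pose Z := h @` [set y | ~ bounded_at y].
have finZ : finite_set Z by exact: unbounded_finite.
have closed_fin (S : set K) : finite_set S -> closed S.
  have /accessible_finite_set_closed := hausdorff_accessible K_hausdorff; exact.
have [g [gy gD]] := rep_regular repB (unbounded_open ny).
have [f Tf] := T_onto g; rewrite -Tf in gy gD.
have fZ k : ~ Z k -> ev k f = 0.
  move=> nZ; have kZ : nbhs k (~` Z).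
    apply: open_nbhs_nbhs; split=> //.
    by apply: closed_openC; exact: closed_fin.
  have [e [ke eZ]] := rep_bump repA kZ.
  have eZ' z : ~ bounded_at z -> \forall l \near h z, ev l e = 0.
    by move=> nz; apply: eZ; rewrite setCK; apply: subset_closure; exists z.
  (* At bounded z, T (e f) (z) = e (h z) T f (z) and T f (z) = 0; at unbounded z, e vanishes near
     [h z]. *)
  have ef0 : e * f = 0.
    apply: T_eq0 => z; have [bz|nz] := pselect (bounded_at z).
      rewrite (weighted_composition _ bz) (rep_mul repA) mulrCA.
      by rewrite -(weighted_composition _ bz) gD ?mulr0//; exact.
    apply: vanish; apply: filterS (eZ' z nz) => l l0.
    by rewrite (rep_mul repA) l0 mul0r.
  have /eqP := rep0 repA k; rewrite -ef0 (rep_mul repA) mulf_eq0.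
  by move=> /orP[/eqP|/eqP].
have [k kf] : exists k, ev k f <> 0.
  apply: contrapT => nf; apply: gy; rewrite (_ : f = 0) ?linear0 ?(rep0 repB)//.
  apply: (rep_faithful repA) => k; apply: contrapT => kf; apply: nf.
  by exists k.
have [z nz hz] : Z k by apply: contrapT => /fZ.
have isolated : nbhs k [set k].
  have kZ : nbhs k (~` (Z `\ k)).
    apply: open_nbhs_nbhs; split; last by move=> [_ /(_ erefl)].
    by apply: closed_openC; apply: closed_fin; exact: finite_setD.
  apply: filterS (filterI kZ (rep_neq0_near repA kf)) => l [nl lf].
  apply: contrapT => lk; apply: nl; split=> //; apply: contrapT.
  by move=> /fZ.
(* Near an isolated point every f' equals a scalar multiple of 1, so its image at z is that multiple
   of T 1 (z). *)
apply: nz; exists (4 * rnorm (T 1)) => f'.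
have -> : ew z (T f') = ew z (T 1) * ev (h z) f'.
  have -> : ew z (T f') = ew z (T (ev (h z) f' *: (1 : A))).
    apply: near_eq; rewrite hz; apply: filterS isolated => l ->.
    by rewrite (rep_scale repA) (rep_one repA) mulr1.
  by rewrite linearZ/= (rep_scale repB) mulrC.
rewrite rnormM.
apply: le_trans (ler_pM (rnorm_ge0 _) (rnorm_ge0 _) (rep_bounded repB _ _)
  (rep_bounded repA _ _)) _.
by have := rnorm_ge0 (T 1); have := rnorm_ge0 f'; nra.
Qed.

Let T_eval y f : ew y (T f) = ew y (T 1) * ev (h y) f.
Proof. exact: weighted_composition. Qed.

Let weight_neq0 y : ew y (T 1) <> 0.
Proof.
move=> w0; have [f Tf] := T_onto 1; have /eqP := rep_one repB y.
by rewrite -Tf T_eval w0 mul0r eq_sym oner_eq0.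
Qed.

(** Each evaluation of T f is continuous in f and the evaluations separate the points of [B], so the
    graph of T is closed. *)
Lemma separating_bijection_bounded :
  exists2 M : R, 0 <= M & forall f, rnorm (T f) <= M * rnorm f.
Proof.
apply: closed_graph_bounded => f g fg; apply: (rep_ext repB) => y.
have [M TM] := bounded_everywhere y.
apply/eqP; rewrite -subr_eq0; apply/eqP/rnorm_eq0/eqP.
rewrite eq_le rnorm_ge0 andbT; apply/ler_addgt0Pr => d d0; rewrite add0r.
(* [|M|] pays for T (f - f') at y, and 2 is the factor of [rep_bounded]. *)
have M0 : 0 < `|M| + 2 by have := normr_ge0 M; lra.
have [f' [ff' gf']] := fg _ (divr_gt0 d0 M0).
apply: le_trans (ler_rdistD (ew y (T f')) _ _) _.
rewrite -!(rep_sub repB) -linearB.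
have := le_trans (TM (f - f')) (ler_wpM2r (rnorm_ge0 _) (ler_norm M)).
have := ler_wpM2l (normr_ge0 M) (ltW ff').
have := rep_bounded repB y (T f' - g); rewrite rdistC.
have : d = (`|M| + 2) * (d / (`|M| + 2)) by field; rewrite gt_eqF.
lra.
Qed.

Lemma separating_bijection_reflects f g : T f * T g = 0 -> f * g = 0.
Proof.
move=> Tfg; apply: (rep_mul_eq0 repA) => k; have [y <-] := h_onto k.
have /eqP := rep0 repB y; rewrite -Tfg (rep_mul repB).
rewrite (T_eval y f) (T_eval y g) !mulf_eq0.
have /eqP/negbTE -> := @weight_neq0 y.
by move=> /orP[/eqP|/eqP]; [left|right].
Qed.

(** If [h y = h z], the formula makes T f vanish at y whenever it vanishes at z, but the images of T
    separate distinct points. *)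
Let h_inj : injective h.
Proof.
move=> y z hyz; apply: contrapT => /eqP yz.
have := rep_hausdorff repB; rewrite open_hausdorff.
move=> /(_ _ _ yz)[[V W]/= [/set_mem Vy /set_mem Wz] [oV oW /eqP VW]].
have [g [gy gV]] := rep_regular repB (open_nbhs_nbhs (conj oV Vy)).
have [f Tf] := T_onto g.
have : ew z g = 0.
  by apply: gV => Vz; have : (V `&` W) z by []; rewrite VW.
rewrite -Tf T_eval -hyz => /eqP; rewrite mulf_eq0 => /orP[/eqP|/eqP hf].
  exact: weight_neq0.
by apply: gy; rewrite -Tf T_eval hf mulr0.
Qed.

Lemma separating_bijection_homeomorphic : homeomorphic K L.
Proof.
have /choice[s hs] := h_onto; have sh : cancel h s by move=> y; exact/h_inj/hs.
exists s, h; split=> // k U skU.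
have cC : closed (h @` (~` U°)).
  apply: compact_closed K_hausdorff _; apply: continuous_compact.
    exact: continuous_subspaceT h_continuous.
  apply: (subclosed_compact (open_closedC (@open_interior _ U))
    (rep_compact repB)).
  by [].
have kC : nbhs k (~` (h @` (~` U°))).
  apply: open_nbhs_nbhs; split; first exact: closed_openC.
  by move=> [y yU hyk]; apply: yU; rewrite -[y]sh hyk.
apply: filterS kC => l lC; suff : U° (s l) by exact: interior_subset.
apply: contrapT => nl.
by apply: lC; exists (s l); [exact: nl|exact: hs].
Qed.

End separating_bijection.

(** * Zero products and disjoint cozero sets *)

Section contfun_separating.
Variables (R : realType) (X : compactHausdorffType) (E : comBanachAlgType R[i]).
Hypothesis semisimpleE : semisimple E.
Implicit Types f g : contfun X E.

(** [coz] ranges over all characters of C(X, E), but those of the form f |-> phi(f(x)) already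
    detect a nonzero product, by semisimplicity of E. *)
Lemma contfun_mul_eq0 f g : f * g = 0 <-> coz f `&` coz g = set0.
Proof.
split=> [fg|fg].
  rewrite -subset0 => phi [/= fphi gphi].
  have /eqP := gelfand0 phi; rewrite -fg gelfandM mulf_eq0.
  by rewrite (negbTE fphi) (negbTE gphi).
apply: contfunP => x; apply: semisimpleE; apply/funext => phi.
rewrite [RHS]gelfand0; apply/eqP.
rewrite -[X in X == _]/(gelfand (f x * g x) phi).
pose chi : contfun X E -> R[i]^o := fun h => gelfand (h x) phi.
have chiP : is_character chi.
  split=> [z h h'|h h'|].
  - exact: gelfand_linear phi z (h x) (h' x).
  - exact: gelfandM phi (h x) (h' x).
  - by exists 1; rewrite /chi gelfand1 oner_neq0.
pose psi : maxspec (contfun X E) :=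
  exist _ (chi : {ptws contfun X E -> R[i]^o}) (mem_set chiP).
apply: contrapT => /negP fgx; have : (coz f `&` coz g) psi.
  move: fgx; rewrite gelfandM mulf_eq0 negb_or => /andP[fx gx].
  by split; [exact: fx|exact: gx].
by rewrite fg.
Qed.

End contfun_separating.

Theorem theorem3 (R : realType) (X Y : compactHausdorffType)
    (E F : comBanachAlgType R[i])
    (semisimpleE : semisimple E) (semisimpleF : semisimple F)
    (ditkinE : ditkin E) (ditkinF : ditkin F)
    (T : {linear contfun X E -> contfun Y F})
    (bijT : bijective T) (sepT : separating T) :
  [/\ continuous T,
      (forall Tinv : contfun Y F -> contfun X E,
         cancel T Tinv -> cancel Tinv T -> separating Tinv) &
      homeomorphic (X * maxspec E)%type (Y * maxspec F)%type].
Proof.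
have repE := @contfun_eval_representation R X E semisimpleE ditkinE.
have repF := @contfun_eval_representation R Y F semisimpleF ditkinF.
have sepT' f g : f * g = 0 -> T f * T g = 0.
  by move=> /(contfun_mul_eq0 semisimpleE)/sepT/(contfun_mul_eq0 semisimpleF).
split.
- have [M M0 TM] := separating_bijection_bounded repE repF bijT sepT'.
  exact: bound_continuous M0 TM.
- move=> S TS ST u v /(contfun_mul_eq0 semisimpleF) uv.
  apply/(contfun_mul_eq0 semisimpleE).
  apply: (separating_bijection_reflects repE repF bijT sepT').
  by rewrite !ST.
- exact: (separating_bijection_homeomorphic repE repF bijT sepT').
Qed.
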